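(* Let $\mathcal{S}\subset\{-1,0,1,2,\dots\}^2$ be a finite set with weights $a(s)\geq 0$ ($s\in\mathcal{S}$) satisfying $\sum_{s\in\mathcal{S}}a(s)=1$ and $\sum_{s\in\mathcal{S}}a(s)s=0$, whose covariance matrix $\mathrm{cov}$ is positive definite. Assume that $C:=\mathrm{cov}^{-\frac12}(\mathbb{R}_+^2)$ is a Weyl chamber of a finite Coxeter group. Let $P$ be the $\mathrm{a}^+$-polynomial on $\mathbb{R}_+^2$ for $L_{\mathcal{S}}$ (which exists and is unique up to a positive multiplicative constant), and let $f$ be the Denisov–Wachtel harmonic function of the random walk with step distribution $a$ killed when exiting the quadrant. Then $f$ coincides with $P$ on $\mathbb{N}^2$ up to a positive multiplicative constant, i.e., there is a constant $\kappa>0$ such that $f(x)=\kappa P(x)$ for all $x\in\mathbb{N}^2$.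
   Context: Here $\mathbb{R}_+=[0,\infty)$ and $\mathbb{N}=\{1,2,3,\dots\}$. The covariance matrix is normalized to have unit diagonal: $\mathrm{cov}=\left(\frac{\sum_{s}a(s)s_is_j}{\sqrt{\sum_s a(s)s_i^2}\,\sqrt{\sum_s a(s)s_j^2}}\right)_{1\leq i,j\leq 2}$, and $\mathrm{cov}^{-\frac12}$ is the inverse of its positive definite square root. The discrete Laplacian is $L_{\mathcal{S}}(g)(x)=\sum_{s\in\mathcal{S}}a(s)g(x+s)-g(x)$. The dominant term of a nonzero polynomial is its homogeneous component of highest degree. A real polynomial $P$ in two variables is an $\mathrm{a}^+$-polynomial on $\mathbb{R}_+^2$ for $L_{\mathcal{S}}$ if $L_{\mathcal{S}}(P)=0$ on $\mathbb{R}_+^2$, $P$ vanishes on $\partial\mathbb{R}_+^2$, and its dominant term is positive on $(0,\infty)^2$. A finite Coxeter group here means a finite subgroup of $O(2)$ generated by reflections through lines containing the origin; its Weyl chambers are the closures of the connected components of the complement of the union of all lines $F$ such that the reflection through $F$ belongs to the group. ''C is a Weyl chamber of a finite Coxeter group'' means that such a group exists having $C$ as one of its Weyl chambers; equivalently the interior angle of $C$ is $\pi/n$ for an integer $n\ge 2$. Let $X(1),X(2),\dots$ be i.i.d. with $\mathbb{P}(X(i)=s)=a(s)$, $S(n)=X(1)+\cdots+X(n)$, and let $\tau_x=\min\{n\geq 1: x+S(n)\notin(0,\infty)^2\}$ be the first exit time of the walk started at $x$. The Denisov–Wachtel harmonic function $f$ is defined (up to a positive multiplicative constant) as follows. Let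 $D$ be the diagonal matrix with entries $\sqrt{\sum_s a(s)s_i^2}$, $i=1,2$, and let $u:C\to\mathbb{R}$ be the réduite of $C$, i.e., the (unique up to positive multiples) continuous function on $C$ that is positive in the interior of $C$, vanishes on $\partial C$ and satisfies $\Delta u=0$ in the interior of $C$. Set $u_0(y)=u(\mathrm{cov}^{-\frac12}D^{-1}y)$ for $y\in\mathbb{R}_+^2$. Then $$f(x)=\lim_{n\to\infty}\mathbb{E}\bigl[u_0(x+S(n));\,\tau_x>n\bigr],\qquad x\in\mathbb{N}^2,$$ and $f$ satisfies $f(x)=\mathbb{E}\bigl[f(x+X(1));\,\tau_x>1\bigr]$ for $x\in\mathbb{N}^2$; it is extended by $0$ on the boundary. *)

(* Defs.v *)
From HB Require Import structures.
From mathcomp Require Import all_boot all_order all_algebra.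
From mathcomp Require Import finmap.
(* The notations of mpoly clash with those of mathcomp-analysis: [mpoly 2 R] is
   the ring usually written {mpoly R[2]}. *)
From mathcomp Require Import -(notations) mpoly.
From mathcomp Require Import all_classical all_reals all_analysis.

Set Implicit Arguments.
Unset Strict Implicit.
Unset Printing Implicit Defensive.

Import Order.TTheory GRing.Theory Num.Theory.
Import numFieldNormedType.Exports.

Local Open Scope classical_set_scope.
Local Open Scope ring_scope.

Definition boundary (T : topologicalType) (A : set T) : set T :=
  closure A `\` interior A.

Section Plane.
Context {R : realType}.
Implicit Types (M : 'M[R]_2) (v w : 'cV[R]_2) (A C : set 'cV[R]_2).

Definition quadrant : set 'cV[R]_2 := [set y | forall i, 0 <= y i 0].

Definition open_quadrant : set 'cV[R]_2 := [set y | forall i, 0 < y i 0].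

Definition dot v w : R := (v^T *m w) 0 0.

Definition posdef M : Prop :=
  M^T = M /\ forall v, v != 0 -> 0 < dot v (M *m v).

(* Junk value 0 when there is no positive definite square root. *)
Definition sqrtmx M : 'M[R]_2 := xget 0 [set Q | posdef Q /\ Q *m Q = M].

Definition orthogonal2 : set 'M[R]_2 := [set M | M *m M^T = 1%:M].

Definition unit_vector v : Prop := dot v v = 1.

(* A line through the origin is given by a unit normal vector [v]. *)
Definition line v : set 'cV[R]_2 := [set x | dot v x = 0].

Definition reflection v : 'M[R]_2 := 1%:M - 2 *: (v *m v^T).

Definition reflections : set 'M[R]_2 := [set reflection v | v in unit_vector].

Definition subgroupO2 (G : set 'M[R]_2) : Prop :=
  [/\ G `<=` orthogonal2, G 1%:M,
      forall M N, G M -> G N -> G (M *m N) &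
      forall M, G M -> G (invmx M)].

Definition finite_coxeter_group (G : set 'M[R]_2) : Prop :=
  finite_set G /\
  exists2 A : set 'M[R]_2, A `<=` reflections & G = smallest subgroupO2 A.

Definition mirrors (G : set 'M[R]_2) : set 'cV[R]_2 :=
  \bigcup_(v in [set v | unit_vector v /\ G (reflection v)]) line v.

Definition weyl_chamber (G : set 'M[R]_2) C : Prop :=
  exists2 x, (~` mirrors G) x &
    C = closure (connected_component (~` mirrors G) x).

Definition partial (i : 'I_2) (u : 'cV[R]_2 -> R) (x : 'cV[R]_2) : R :=
  'D_(delta_mx i 0) u x.

Definition C2_on A (u : 'cV[R]_2 -> R) : Prop :=
  forall x, A x -> forall i j : 'I_2,
    [/\ derivable u x (delta_mx i 0),
        derivable (partial i u) x (delta_mx j 0) &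
        {for x, continuous (partial j (partial i u))}].

Definition laplacian (u : 'cV[R]_2 -> R) (x : 'cV[R]_2) : R :=
  \sum_(i < 2) partial i (partial i u) x.

(* The values of [u] outside of [C] are irrelevant. *)
Definition is_reduite C (u : 'cV[R]_2 -> R) : Prop :=
  [/\ {within C, continuous u},
      forall y, interior C y -> 0 < u y,
      forall y, boundary C y -> u y = 0,
      C2_on (interior C) u &
      forall y, interior C y -> laplacian u y = 0].

Definition peval (P : mpoly 2 R) (x : 'cV[R]_2) : R :=
  meval (fun i => x i 0) P.

(* For P != 0, [mmeasure mdeg P] is one more than the total degree of P. *)
Definition dominant_term (P : mpoly 2 R) : mpoly 2 R :=
  pihomog mdeg (mmeasure mdeg P).-1 P.

End Plane.

Section Steps.
Context {R : realType}.
Variables (S : {fset 'cV[int]_2}) (a : 'cV[int]_2 -> R).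

Definition toR (s : 'cV[int]_2) : 'cV[R]_2 := \col_i (s i 0)%:~R.

Definition stddev (i : 'I_2) : R :=
  Num.sqrt (\sum_(s <- S) a s * toR s i 0 ^+ 2).

Definition cov : 'M[R]_2 :=
  \matrix_(i, j) ((\sum_(s <- S) a s * toR s i 0 * toR s j 0)
                  / (stddev i * stddev j)).

Definition cov_invsqrt : 'M[R]_2 := invmx (sqrtmx cov).

Definition cone : set 'cV[R]_2 := [set cov_invsqrt *m y | y in quadrant].

Definition discrete_laplacian (g : 'cV[R]_2 -> R) (x : 'cV[R]_2) : R :=
  \sum_(s <- S) a s * g (x + toR s) - g x.

Definition aplus_polynomial (P : mpoly 2 R) : Prop :=
  [/\ forall x, quadrant x -> discrete_laplacian (peval P) x = 0,
      forall x, boundary quadrant x -> peval P x = 0 &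
      forall x, open_quadrant x -> 0 < peval (dominant_term P) x].

Definition reduite_pullback (u : 'cV[R]_2 -> R) (y : 'cV[R]_2) : R :=
  u (cov_invsqrt *m (invmx (diag_mx (\row_i stddev i)) *m y)).

End Steps.

Section Walk.
Context {R : realType} {d : measure_display} {T : measurableType d}.
Variable Pr : probability T R.
(* [X k] is the (k+1)-th step of the walk. *)
Variable X : nat -> T -> 'cV[int]_2.

(* Z^2 carries its discrete sigma-algebra; independence is mutual. *)
Definition iid_steps (S : {fset 'cV[int]_2}) (a : 'cV[int]_2 -> R) : Prop :=
  [/\ forall k (A : set 'cV[int]_2), measurable (X k @^-1` A),
      forall k s, s \in S -> Pr (X k @^-1` [set s]) = (a s)%:E &
      forall (J : {fset nat}) (A : nat -> set 'cV[int]_2),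
        Pr (\bigcap_(k in [set` J]) (X k @^-1` A k)) =
        (\prod_(k <- J) Pr (X k @^-1` A k))%E].

Definition walk (n : nat) (w : T) : 'cV[int]_2 := \sum_(k < n) X k w.

(* +oo when the walk started at [x] never exits. *)
Definition exit_time (x : 'cV[int]_2) (w : T) : \bar R :=
  ereal_inf [set n%:R%:E | n in
    [set n : nat | (1 <= n)%N /\ ~ open_quadrant (toR (x + walk n w) : 'cV[R]_2)]].

(* E[u_0(x + S(n)); tau_x > n] *)
Definition killed_expectation (u0 : 'cV[R]_2 -> R) (x : 'cV[int]_2) (n : nat)
    : \bar R :=
  (\int[Pr]_(w in [set w | n%:R%:E < exit_time x w])
     (u0 (toR (x + walk n w)))%:E)%E.

(* [u] is the reduite of [cone S a]. *)
Definition dw_harmonic (S : {fset 'cV[int]_2}) (a : 'cV[int]_2 -> R)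
    (u : 'cV[R]_2 -> R) (x : 'cV[int]_2) : \bar R :=
  limn (killed_expectation (reduite_pullback S a u) x).

End Walk.

(* Main.v *)
(** The dominant term [H] of [P] satisfies the continuous Laplace equation obtained as
the second order part of [L P = 0], and it vanishes on the axes. After the linear change
of coordinates [x |-> zeta(x) = x_0 + l x_1 exp (i b)] this forces [H = kappa Im (zeta ^ d)],
and positivity forces [b = pi / d].

The reduite of the sector [0 <= arg <= pi / d] is [Im (zeta ^ d)] up to a constant: on
each arc [|zeta| = R] a positive harmonic function [u] vanishing on the edges is uniformly
close to a nonnegative sine polynomial [sum_k c_k sin (k d t)], by the maximum principle
it is close to [sum_k c_k (r / R) ^ (k d) sin (k d t)] inside, and nonnegativity gives
[|c_k| <= k c_1]; letting [R] tend to infinity only the term [k = 1] survives.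

The steps being at least [-1], the walk exits on the axes, where [P] vanishes, so that
[E (P (x + S(n)); tau > n) = P x] for all [n]. Since [|P - H| <= C H / |x|], the same
expectation for [H] tends to [P x] as soon as the surviving walk leaves every bounded
set. It does: from a bounded set the walk exits within [m] steps with a probability
bounded below, and the survival probabilities converge. *)
Require Import Defs.
From HB Require Import structures.
From mathcomp Require Import all_boot all_order all_algebra.
From mathcomp Require Import finmap.
From mathcomp Require Import -(notations) mpoly.
From mathcomp Require Import all_classical all_reals all_analysis.
From mathcomp Require Import measurable_realfun.
From mathcomp Require Import ring lra zify.
Import Order.TTheory GRing.Theory Num.Theory.
Import numFieldNormedType.Exports.
Local Open Scope classical_set_scope.
Local Open Scope ring_scope.

Set Implicit Arguments.
Unset Strict Implicit.
Unset Printing Implicit Defensive.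

(** * Approximation by sine polynomials *)

(** The reduite is known only through its defining properties, and its formula is obtained without
    Poisson kernel or boundary Harnack inequality. What makes this elementary is d b = pi: the
    stretched angle d t runs over [0, pi], and every Im (zeta ^ (k d)) vanishes on both edges. The
    approximating sine polynomial has to be nonnegative, for only then does its first coefficient
    control all the others.

    The number l is the ratio of the standard deviations and cos b = - rho with rho the correlation.
    Up to a factor, zeta is then a conformal coordinate on C read in the original quadrant, so that
    the dominant term and the pulled back reduite are multiples of the same function.

    The estimate |P - H| <= C H / |x| is delicate near the axes, where H is small. It holds because
    every monomial of P contains x y, while H is at least a constant times x y (x + y) ^ (d - 2).
    Before near and far points are separated, the killed expectations of H have to be bounded
    uniformly in n; this comes from H <= 2 P + constant. *)

Section Bernstein.
Context {R : realType}.
Implicit Types (f g : nat -> R) (t : R).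

(** Expectation of [f] at a binomial variable with [n] trials of success probability [t], by
    conditioning on one trial. Monotonicity, affinity and second moments follow by induction without
    binomial coefficients. *)
Fixpoint bernstein (n : nat) f t : R :=
  if n is m.+1 then t * bernstein m (fun j => f j.+1) t
                    + (1 - t) * bernstein m f t
  else f 0%N.

Lemma le_bernstein n f g t : 0 <= t <= 1 -> (forall j, (j <= n)%N -> f j <= g j) ->
  bernstein n f t <= bernstein n g t.
Proof.
move=> /andP[t0 t1]; elim: n f g => [|n IH] f g fg /=; first exact: fg.
apply: lerD; apply: ler_wpM2l; rewrite ?subr_ge0//; apply: IH => j jn.
  by apply: fg.
by apply: fg; rewrite leqW.
Qed.

Lemma bernstein_affine n f t (b c : R) :
  bernstein n (fun j => b + c * f j) t = b + c * bernstein n f t.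
Proof.
elim: n f => [//|n IH] f /=; rewrite !IH; ring.
Qed.

Lemma bernstein_ge0 n f t : 0 <= t <= 1 -> (forall j, 0 <= f j) ->
  0 <= bernstein n f t.
Proof.
move=> t01 f0; have := @bernstein_affine n f t 0 0.
rewrite mul0r addr0 => <-; apply: le_bernstein => // j _.
by rewrite mul0r addr0.
Qed.

(** Squared bias plus binomial variance. The centre [c] is arbitrary because the induction shifts it
    by one. *)
Lemma bernstein_sqr n t (c : R) :
  bernstein n (fun j => (j%:R - c) ^+ 2) t
  = (n%:R * t - c) ^+ 2 + n%:R * t * (1 - t).
Proof.
elim: n c => [|n IH] c /=; first by rewrite !mul0r addr0.
have -> : (fun j : nat => (j.+1%:R - c) ^+ 2) = (fun j => (j%:R - (c - 1)) ^+ 2).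
  by apply/funext => j; rewrite -natr1; ring.
by rewrite !IH -natr1; ring.
Qed.

(* The variance of the Bernstein weights is at most [1 / (4 n)]. *)
Lemma bernstein_approx n (F : R -> R) t (v e K : R) : 0 <= t <= 1 -> 0 <= K ->
  (forall j, (j <= n.+1)%N ->
     `|F (j%:R / n.+1%:R) - v| <= e + K * (j%:R / n.+1%:R - t) ^+ 2) ->
  `|bernstein n.+1 (fun j => F (j%:R / n.+1%:R)) t - v| <= e + K / n.+1%:R.
Proof.
move=> t01 K0 H; set N := n.+1; have N0 : (0 : R) < N%:R by rewrite ltr0n.
have Nn0 : (N%:R : R) != 0 by rewrite gt_eqF.
set D := K / N%:R ^+ 2; pose q (j : nat) := (j%:R - N%:R * t) ^+ 2.
have D0 : 0 <= D by rewrite divr_ge0// exprn_ge0// ltW.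
have qE (j : nat) : K * (j%:R / N%:R - t) ^+ 2 = D * q j.
  by rewrite /D /q; field.
have bq : D * bernstein N q t <= K / N%:R.
  rewrite /q bernstein_sqr subrr expr0n add0r /D.
  have -> : K / N%:R ^+ 2 * (N%:R * t * (1 - t)) = K / N%:R * (t * (1 - t)).
    by field.
  by rewrite ler_piMr ?divr_ge0// ?ltW//; case/andP: t01 => *; nra.
rewrite ler_norml; apply/andP; split.
  rewrite lerBrDl opprD addrA; apply: (@le_trans _ _ ((v - e) + - D * bernstein N q t)).
    by rewrite mulNr lerB.
  rewrite -bernstein_affine; apply: le_bernstein => // j jn.
  have := H j jn; rewrite qE mulNr => /ler_normlP[]; lra.
rewrite lerBlDl addrA; apply: (@le_trans _ _ ((v + e) + D * bernstein N q t)).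
  rewrite -bernstein_affine; apply: le_bernstein => // j jn.
  have := H j jn; rewrite qE => /ler_normlP[]; lra.
by rewrite lerD2l.
Qed.

End Bernstein.

(** * Discrete orthogonality of the sines and closure properties of sine polynomials *)

Section SinePolynomials.
Context {R : realType}.
Implicit Types (k l m n : nat) (x : R).

Lemma sin_natpi k : sin (k%:R * pi) = 0 :> R.
Proof.
elim: k => [|k IH]; first by rewrite mul0r sin0.
by rewrite -natr1 mulrDl mul1r sinDpi IH oppr0.
Qed.

Lemma cos_natpi k : cos (k%:R * pi) = (-1) ^+ k :> R.
Proof.
elim: k => [|k IH]; first by rewrite mul0r cos0.
by rewrite -natr1 mulrDl mul1r cosDpi IH exprS mulN1r.
Qed.

Lemma abs_sin_le k x : 0 <= x <= pi -> `|sin (k%:R * x)| <= k%:R * sin x.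
Proof.
move=> x0; have s0 := sin_ge0_pi x0; elim: k => [|k IH].
  by rewrite !mul0r sin0 normr0.
rewrite -natr1 !mulrDl !mul1r sinD (le_trans (ler_normD _ _))// !normrM.
apply: lerD.
  by rewrite (le_trans _ IH)// ler_piMr// cos_max.
by rewrite (ger0_norm s0) ler_piMl// cos_max.
Qed.

(** Dirichlet kernel: the factor [2 * sin (x / 2)] makes the sum telescope. *)
Lemma sum_cos m x : (2 * sin (x / 2)) * (\sum_(j < m) cos (j%:R * x))
  = sin (m%:R * x - x / 2) + sin (x / 2).
Proof.
elim: m => [|m IH]; first by rewrite big_ord0 mulr0 mul0r add0r sinN addNr.
rewrite big_ord_recr /= mulrDr IH -(natr1 m).
rewrite [in RHS](_ : (m%:R + 1) * x - x / 2 = m%:R * x + x / 2); last by field.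
by rewrite !sinD sinN cosN; ring.
Qed.

Lemma sum_cos_roots m l : (0 < l < m.*2)%N ->
  \sum_(j < m) cos (j%:R * (l%:R * pi / m%:R)) = (1 - (-1) ^+ l) / 2 :> R.
Proof.
move=> /andP[l0 lm]; have m0 : (0 < m)%N by case: m lm.
have mR : (0 : R) < m%:R by rewrite ltr0n.
have mN : (m%:R : R) != 0 by rewrite gt_eqF.
set x := l%:R * pi / m%:R.
have s0 : 0 < sin (x / 2).
  apply: sin_gt0_pi; rewrite /x; apply/andP; split.
    by rewrite !divr_gt0// mulr_gt0 ?ltr0n// pi_gt0.
  rewrite -mulrA -invfM mulrAC gtr_pMl ?pi_gt0// ltr_pdivrMr ?mulr_gt0// mul1r.
  by rewrite mulr_natr -mulrnA ltr_nat muln2.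
have := sum_cos m x; set S := \sum_(_ < _) _ => E.
have xm : m%:R * x = l%:R * pi by rewrite /x; field.
move: E; rewrite xm sinB sin_natpi cos_natpi => E.
have sN : sin (x / 2) != 0 by rewrite gt_eqF.
apply: (mulfI sN); apply: (@mulfI _ 2) => //.
by rewrite mulrA E; field.
Qed.

(** The product of sines is half a difference of cosines with indices [k - l] and [k + l]. These
    have the same parity, so their sums agree unless [k = l], where the first sum is [m] and the
    second is 0. *)
Lemma sum_sin_sin m k l : (k < m)%N -> (0 < l < m)%N ->
  \sum_(j < m) sin (k%:R * (j%:R * pi / m%:R)) * sin (l%:R * (j%:R * pi / m%:R))
  = if k == l then m%:R / 2 else 0 :> R.
Proof.
wlog lk : k l / (l <= k)%N.
  move=> H km lm; have [lk|kl] := leqP l k; first exact: H.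
  case: (posnP k) => [->|k0].
    rewrite big1 => [|j _]; last by rewrite mul0r sin0 mul0r.
    by rewrite lt_eqF//; case/andP: lm.
  have -> : \sum_(j < m) sin (k%:R * (j%:R * pi / m%:R)) *
      sin (l%:R * (j%:R * pi / m%:R)) =
      \sum_(j < m) sin (l%:R * (j%:R * pi / m%:R)) *
      sin (k%:R * (j%:R * pi / m%:R)) :> R.
    by apply: eq_bigr => j _; rewrite mulrC.
  rewrite H//; first by rewrite eq_sym.
  - exact: ltnW.
  - by case/andP: lm.
  - by rewrite k0.
move=> km /andP[l0 lm].
have E (j : nat) : sin (k%:R * (j%:R * pi / m%:R)) * sin (l%:R * (j%:R * pi / m%:R))
   = 2^-1 * (cos (j%:R * ((k - l)%:R * pi / m%:R))
     - cos (j%:R * ((k + l)%:R * pi / m%:R))) :> R.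
  rewrite (_ : j%:R * ((k + l)%:R * pi / m%:R) = k%:R * (j%:R * pi / m%:R) +
       l%:R * (j%:R * pi / m%:R)); last by rewrite natrD; ring.
  rewrite (_ : j%:R * ((k - l)%:R * pi / m%:R) = k%:R * (j%:R * pi / m%:R) -
       l%:R * (j%:R * pi / m%:R)); last by rewrite natrB//; ring.
  by rewrite !cosD cosN sinN; field.
under eq_bigr do rewrite E.
rewrite -mulr_sumr sumrB (@sum_cos_roots m (k + l)); last first.
  by rewrite addn_gt0 l0 orbT/= -addnn -addSn leq_add// ltnW.
case: eqVneq => [->|kl].
  rewrite subnn; under eq_bigr do rewrite !mul0r mulr0 cos0.
  by rewrite sumr_const card_ord addnn -mul2n exprM sqrrN expr1n expr1n; field.
have lk' : (l < k)%N by rewrite ltn_neqAle eq_sym kl.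
rewrite sum_cos_roots; last first.
  by rewrite subn_gt0 lk'/= -addnn (leq_ltn_trans (leq_subr _ _))// ltn_addr.
by rewrite -(subnK lk) addnK -addnA exprD addnn -mul2n exprM sqrrN !expr1n mulr1 subrr mulr0.
Qed.

Definition sinepoly n (c : nat -> R) x : R := \sum_(k < n) c k * sin (k%:R * x).

(* The sine coefficients are recovered by the discrete orthogonality of the
   sines at the nodes [j pi / m], and [k sin x +- sin (k x)] is nonnegative. *)
Lemma sinepoly_coef_le n (c : nat -> R) : (forall k, (n <= k)%N -> c k = 0) ->
  (forall x, 0 <= x <= pi -> 0 <= sinepoly n c x) ->
  forall k, (0 < k)%N -> `|c k| <= k%:R * c 1%N.
Proof.
(* The number of nodes exceeds every index that occurs: those below [n], [k] and 1. *)
move=> cn Q0 k k0; set m := (n + k).+2.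
have mR : (0 : R) < m%:R by rewrite ltr0n.
pose p (j : nat) : R := j%:R * pi / m%:R.
have p01 (j : 'I_m) : 0 <= p j <= pi.
  apply/andP; split; first by rewrite divr_ge0 ?mulr_ge0 ?ler0n// pi_ge0.
  by rewrite /p mulrAC ler_piMl ?pi_ge0// ler_pdivrMr// mul1r ler_nat ltnW.
have coefE l : (0 < l < m)%N ->
    \sum_(j < m) sinepoly n c (p j) * sin (l%:R * p j) = m%:R / 2 * c l.
  move=> /andP[l0 lm].
  under eq_bigr do rewrite mulr_suml.
  rewrite exchange_big/=.
  have -> : \sum_(i < n) \sum_(j < m) c i * sin (i%:R * p j) * sin (l%:R * p j)
      = \sum_(i < n) c i * (if i == l :> nat then m%:R / 2 else 0).
    apply: eq_bigr => i _; rewrite -sum_sin_sin ?l0//; last first.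
      by rewrite /m -addnS -addnS ltn_addr// ltn_ord.
    by rewrite mulr_sumr; apply: eq_bigr => j _; rewrite mulrA.
  have [ln|nl] := ltnP l n.
    rewrite (bigD1 (Ordinal ln))//= eqxx big1 ?addr0 1?mulrC// => i il.
    by rewrite ifF ?mulr0//; apply/negbTE; apply: contra_neq il => il; exact/val_inj.
  rewrite cn// mulr0 big1// => i _; rewrite ifF ?mulr0//.
  by apply/negbTE; rewrite ltn_eqF// (leq_trans (ltn_ord i)).
have k1 : (0 < k < m)%N by rewrite k0 /m -addnS -addnS ltn_addl.
have m2 : 0 < m%:R / 2 :> R by rewrite divr_gt0.
rewrite ler_norml; apply/andP; split.
  rewrite -subr_ge0 opprK -(pmulr_rge0 _ m2) mulrDr -coefE//.
  rewrite mulrCA -(coefE 1%N)// mulr_sumr -big_split/=.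
  apply: sumr_ge0 => j _; rewrite [X in _ + X]mulrCA -mulrDr mulr_ge0 ?Q0//.
  by have := abs_sin_le k (p01 j); rewrite mul1r ler_norml => /andP[? _]; lra.
rewrite -subr_ge0 -(pmulr_rge0 _ m2) mulrBr -(coefE k)//.
rewrite mulrCA -(coefE 1%N)// mulr_sumr -sumrB.
apply: sumr_ge0 => j _; rewrite [X in X - _]mulrCA -mulrBr mulr_ge0 ?Q0//.
by have := abs_sin_le k (p01 j); rewrite mul1r ler_norml => /andP[_ ?]; lra.
Qed.

Definition is_sinepoly (q : R -> R) : Prop :=
  exists n c, (forall k, (n <= k)%N -> c k = 0) /\ q = sinepoly n c.

Lemma sinepoly_widen n m c : (forall k, (n <= k)%N -> c k = 0) -> (n <= m)%N ->
  sinepoly n c = sinepoly m c.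
Proof.
move=> cn nm; apply/funext => x; rewrite /sinepoly.
rewrite (big_ord_widen m (fun k => c k * sin (k%:R * x)))// big_mkcond/=.
by apply: eq_bigr => k _; case: ltnP => // nk; rewrite cn ?mul0r.
Qed.

Lemma is_sinepolyD q r : is_sinepoly q -> is_sinepoly r ->
  is_sinepoly (fun x => q x + r x).
Proof.
move=> [n [c [cn ->]]] [m [e [em ->]]].
exists (maxn n m), (fun k => c k + e k); split.
  by move=> k; rewrite geq_max => /andP[? ?]; rewrite cn// em// addr0.
rewrite (sinepoly_widen cn (leq_maxl n m)) (sinepoly_widen em (leq_maxr n m)).
apply/funext => x; rewrite /sinepoly -big_split/=.
by apply: eq_bigr => k _; rewrite mulrDl.
Qed.

Lemma is_sinepolyZ a q : is_sinepoly q -> is_sinepoly (fun x => a * q x).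
Proof.
move=> [n [c [cn ->]]]; exists n, (fun k => a * c k); split.
  by move=> k nk; rewrite cn// mulr0.
apply/funext => x; rewrite /sinepoly mulr_sumr.
by apply: eq_bigr => k _; rewrite mulrA.
Qed.

Lemma is_sinepoly_sin k : is_sinepoly (fun x => sin (k%:R * x)).
Proof.
exists k.+1, (fun j => (j == k)%:R); split.
  by move=> j kj; rewrite gtn_eqF.
apply/funext => x; rewrite /sinepoly (bigD1 ord_max)//= eqxx mul1r big1 ?addr0//.
move=> j jk; have -> : (j == k :> nat) = false by apply/negbTE.
by rewrite mul0r.
Qed.

Lemma is_sinepoly_cos q : is_sinepoly q -> is_sinepoly (fun x => cos x * q x).
Proof.
move=> [n [c [cn ->]]].
have -> : (fun x => cos x * sinepoly n c x)
    = (fun x => \sum_(k < n) c k * (cos x * sin (k%:R * x))).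
  apply/funext => x; rewrite mulr_sumr; apply: eq_bigr => k _; ring.
elim: n {cn} => [|n IH].
  under eq_fun do rewrite big_ord0.
  have := is_sinepolyZ 0 (is_sinepoly_sin 0).
  by under eq_fun do rewrite mul0r.
under eq_fun do rewrite big_ord_recr/=.
apply: is_sinepolyD => //; apply: is_sinepolyZ.
case: n {IH} => [|n].
  have := is_sinepoly_sin 0.
  by congr is_sinepoly; apply/funext => x; rewrite mul0r sin0 mulr0.
have -> : (fun x => cos x * sin (n.+1%:R * x))
   = (fun x => 2^-1 * (sin (n.+2%:R * x) + sin (n%:R * x))).
  apply/funext => x.
  rewrite (_ : n.+2%:R * x = n.+1%:R * x + x); last by rewrite -(natr1 n.+1); ring.
  rewrite (_ : n%:R * x = n.+1%:R * x - x); last by rewrite -natr1; ring.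
  by rewrite !sinD sinN cosN; field.
by apply/is_sinepolyZ/is_sinepolyD; exact: is_sinepoly_sin.
Qed.

(** Each step of the recursion multiplies by [t] or [1 - t] with [t = (1 - cos x) / 2], hence by an
    affine function of [cos x], and such products preserve sine polynomials. *)
Lemma is_sinepoly_bernstein n (f : nat -> R) :
  is_sinepoly (fun x => sin x * bernstein n f ((1 - cos x) / 2)).
Proof.
elim: n f => [|n IH] f /=.
  under eq_fun do rewrite mulrC -[X in sin X]mul1r.
  exact/is_sinepolyZ/(is_sinepoly_sin 1).
set q := fun x => sin x * bernstein n (fun j => f j.+1) ((1 - cos x) / 2).
set r := fun x => sin x * bernstein n f ((1 - cos x) / 2).
have -> : (fun x => sin x * ((1 - cos x) / 2 * bernstein n (fun j => f j.+1) ((1 - cos x) / 2) +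
          (1 - (1 - cos x) / 2) * bernstein n f ((1 - cos x) / 2))) =
   (fun x => 2^-1 * (q x + r x + (-1 * (cos x * q x) + cos x * r x))).
  by apply/funext => x; rewrite /q /r; field.
apply/is_sinepolyZ/is_sinepolyD; first by apply: is_sinepolyD; exact: IH.
by apply: is_sinepolyD; rewrite ?mulN1r; [apply: is_sinepolyZ|]; apply/is_sinepoly_cos/IH.
Qed.

End SinePolynomials.

(** * Uniform approximation by nonnegative sine polynomials *)

Section SineApproximation.
Context {R : realType}.

(** A modulus of continuity in the quadratic form that [bernstein_approx] consumes. On the compact
    set of pairs with [|F x - F y| >= e] the square is bounded below, the cosine being injective on
    [0, pi]; [K] is the maximal oscillation divided by this bound. *)
Lemma cos_modulus (F : R -> R) (e : R) : continuous F -> 0 < e ->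
  exists2 K, 0 <= K & forall x y, 0 <= x <= pi -> 0 <= y <= pi ->
    `|F x - F y| <= e + K * (cos x - cos y) ^+ 2.
Proof.
move=> cF e0; pose I : set R := `[0, pi]%classic.
pose D (p : R * R) : R := `|F p.1 - F p.2|.
have c1 (f : R -> R) : continuous f -> continuous (fun p : R * R => f p.1).
  by move=> cf p; apply: (@continuous_comp _ _ _ fst f); [exact: cvg_fst|exact: cf].
have c2 (f : R -> R) : continuous f -> continuous (fun p : R * R => f p.2).
  by move=> cf p; apply: (@continuous_comp _ _ _ snd f); [exact: cvg_snd|exact: cf].
have cD : continuous D.
  move=> p; apply: cvg_norm.
  by apply: cvgB; [exact: c1|exact: c2].
pose q (p : R * R) : R := (cos p.1 - cos p.2) ^+ 2.
have cq : continuous q.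
  move=> p; rewrite /q.
  have -> : (fun p : R * R => (cos p.1 - cos p.2) ^+ 2) =
    (fun p => (cos p.1 - cos p.2) * (cos p.1 - cos p.2)).
    by apply/funext => ?; rewrite expr2.
  by apply: cvgM; (apply: cvgB; [exact: (c1 _ (@continuous_cos R))|exact: (c2 _ (@continuous_cos R))]).
pose J := (I `*` I) `&` D @^-1` [set t | e <= t].
have cJ : compact J.
  apply: compact_closedI.
    by apply: compact_setX; exact: segment_compact.
  by apply: closed_comp; [move=> p _; exact: cD|exact: closed_ge].
have [J0|J0] := pselect (J !=set0); last first.
  exists 0 => // x y x0 y0; rewrite mul0r addr0.
  rewrite leNgt; apply/negP => exy; apply: J0; exists (x, y); split => /=; last exact: ltW.
  by split; rewrite /I /= in_itv.
have [p] := compact_EVT_min J0 cJ (continuous_subspaceT cq).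
rewrite inE => -[[p1 p2] /= Dp] pmin.
have [r _ rmax] := compact_EVT_max J0 cJ (continuous_subspaceT cD).
have qp : 0 < q p.
  rewrite exprn_even_gt0//= subr_eq0; apply/negP => /eqP /cos_inj.
  rewrite !inE => /(_ p1 p2) pp; move: Dp; rewrite /D pp subrr normr0.
  by rewrite leNgt e0.
have Dr : 0 <= D r by rewrite normr_ge0.
exists (D r / q p); first by rewrite divr_ge0// ltW.
move=> x y x0 y0; have [le|lt] := leP `|F x - F y| e.
  by rewrite (le_trans le)// lerDl mulr_ge0 ?sqr_ge0// divr_ge0// ltW.
have Jxy : J (x, y).
  by split => /=; [split; rewrite /I /= in_itv|rewrite ltW].
have Dxy := rmax (x, y) (mem_set Jxy); have qxy := pmin (x, y) (mem_set Jxy).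
rewrite (le_trans Dxy)// -[leLHS]add0r lerD ?(ltW e0)//.
rewrite mulrAC ler_pdivlMr// ler_wpM2l//.
Qed.

(* The cut-off [max 0 (g - e)] vanishes near [0] and [pi], so that its quotient
   by the sine is continuous and can be approximated by a polynomial in the cosine. *)
Lemma sinepoly_approx (g : R -> R) (e : R) : continuous g ->
  (forall x, 0 <= g x) -> (forall x : R, ~ (0 < x < pi) -> g x = 0) -> 0 < e ->
  exists n c, [/\ forall k, (n <= k)%N -> c k = 0,
    forall x, 0 <= x <= pi -> 0 <= sinepoly n c x &
    forall x, 0 <= x <= pi -> `|g x - sinepoly n c x| <= e].
Proof.
(* Error budget: one [d] for the cut-off, one for the modulus of [F], one for the Bernstein
   error. *)
move=> cg g0 gout e0; set d := e / 4.
have d0 : 0 < d by rewrite divr_gt0.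
pose G x : R := Num.max 0 (g x - d).
have cG : continuous G.
  move=> x; apply: (@continuous_max _ _ (fun=> 0) (fun x => g x - d)).
    exact: cvg_cst.
  by apply: cvgB; [exact: cg|exact: cvg_cst].
have G0 x : 0 <= G x by rewrite /G le_max lexx.
have gG x : `|g x - G x| <= d.
  rewrite /G; case: (leP 0 (g x - d)) => h; first by rewrite opprB addrCA subrr addr0 ger0_norm// ltW.
  by rewrite subr0 ger0_norm//; lra.
pose F x := G x / sin x.
have cF : continuous F.
  move=> x; have [x0|/gout x0] := pselect (0 < x < pi).
    apply: cvgM; first exact: cG.
    by apply: cvgV; [rewrite gt_eqF// sin_gt0_pi|exact: continuous_sin].
  have Fx : F x = 0 by rewrite /F /G x0 max_l ?mul0r//; lra.
  rewrite /continuous_at Fx; apply: cvg_near_cst.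
  have gx : g x < d by rewrite x0.
  apply: filterS (cvgr_lt _ (cg x) _ gx) => y gy.
  by rewrite /F /G max_l ?mul0r//; lra.
have [K K0 FK] := cos_modulus cF d0.
have sF x : 0 <= x <= pi -> sin x * F x = G x.
  move=> /andP[]; rewrite le_eqVlt => /predU1P[<- _|x0].
    by rewrite sin0 mul0r /G gout ?ltxx// max_l//; lra.
  rewrite le_eqVlt => /predU1P[->|xpi].
    by rewrite sinpi mul0r /G gout ?ltxx ?andbF// max_l//; lra.
  by rewrite /F mulrC divfK// gt_eqF// sin_gt0_pi// x0.
have F0 x : 0 <= x <= pi -> 0 <= F x.
  by move=> x0; rewrite divr_ge0// sin_ge0_pi.
(* In the variable [t] with [cos x = 1 - 2 t], a squared difference of cosines is 4 times a squared
   difference of [t]. *)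
have [N NK] : exists N : nat, 4 * K / N.+1%:R <= d.
  exists (Num.truncn (4 * K / d)); rewrite ler_pdivrMr// [d * _]mulrC -ler_pdivrMr//.
  by rewrite ltW// truncnS_gt.
(* The minimum keeps the argument of [acos] in [-1, 1] for all [j], since [bernstein_ge0] asks for
   nonnegativity at every index. *)
pose f (j : nat) := F (acos (1 - 2 * Num.min 1 (j%:R / N.+1%:R))).
have t01 (t : R) : 0 <= t -> -1 <= 1 - 2 * Num.min 1 t <= 1.
  by move=> t0; case: (leP 1 t) => h; apply/andP; split; lra.
have acos01 (t : R) : -1 <= t <= 1 -> 0 <= acos t <= pi.
  by move=> ht; rewrite acos_ge0// acos_lepi.
have [n [c [cn Qc]]] := is_sinepoly_bernstein N.+1 f.
have cos01 (x : R) : 0 <= (1 - cos x) / 2 <= 1.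
  by have := cos_le1 x; have := cos_geN1 x => ? ?; apply/andP; split; lra.
exists n, c; split => // x x0; rewrite -Qc.
  rewrite mulr_ge0 ?sin_ge0_pi// bernstein_ge0// => j.
  by apply/F0/acos01/t01; rewrite divr_ge0.
have -> : g x - sin x * bernstein N.+1 f ((1 - cos x) / 2) = (g x - G x) +
    sin x * (F x - bernstein N.+1 f ((1 - cos x) / 2)).
  by rewrite mulrBr sF//; ring.
rewrite (le_trans (ler_normD _ _))//.
have -> : e = d + 3 * d by rewrite /d; field.
rewrite lerD// normrM; apply: (@le_trans _ _ (1 * (d + (4 * K) / N.+1%:R))); last first.
  rewrite mul1r (_ : 3 * d = d + d + d); last by ring.
  by rewrite (le_trans (lerD (lexx d) NK))// lerDl ltW.
apply: ler_pM => //; first exact: sin_max.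
rewrite distrC; apply: (@bernstein_approx _ _ (fun t => F (acos (1 - 2 * Num.min 1 t)))) => //.
  by rewrite mulr_ge0.
move=> j jN; set t := j%:R / _.
have t0 : 0 <= t by rewrite divr_ge0.
have t1 : t <= 1 by rewrite ler_pdivrMr// mul1r ler_nat.
rewrite (le_trans (FK _ _ (acos01 _ (t01 _ t0)) x0))//.
rewrite acosK ?in_itv/= ?t01//.
have -> : Num.min 1 t = t by rewrite min_r.
by rewrite lerD2l le_eqVlt; apply/orP; left; apply/eqP; field.
Qed.

End SineApproximation.

(** The term of index [n + 2] is at most [c 1 * s ^ 2] times (n + 2) / 4 ^ n, and (n + 2) / 4 ^ n <=
    2 / 2 ^ n. The geometric partial sums [4 - 4 / 2 ^ n] make the induction go through. *)
Lemma sinepoly_tail (R : realType) n (c : nat -> R) (s x : R) :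
  (forall k, (n <= k)%N -> c k = 0) ->
  (forall k, (0 < k)%N -> `|c k| <= k%:R * c 1%N) -> 0 <= s <= 1 / 4 ->
  `|sinepoly n (fun k => c k * s ^+ k) x - c 1%N * (s * sin x)| <= 4 * c 1%N * s ^+ 2.
Proof.
move=> cn ck /andP[s0 s4].
(* With two more terms the induction starts at the linear part, where the difference is 0. *)
rewrite (@sinepoly_widen _ n n.+2); last 2 first.
- by move=> k nk; rewrite cn// mul0r.
- exact: ltnW.
have c1 : 0 <= c 1%N by have := le_trans (normr_ge0 _) (ck 1%N isT); rewrite mul1r.
apply: (@le_trans _ _ (c 1%N * s ^+ 2 * (4 - 4 / 2 ^+ n))); last first.
  rewrite [leRHS](_ : _ = c 1%N * s ^+ 2 * 4); last by ring.
  apply: ler_wpM2l; first by rewrite mulr_ge0// sqr_ge0.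
  by rewrite lerBlDr lerDl divr_ge0// exprn_ge0.
elim: n {cn} => [|n IH].
  rewrite /sinepoly !big_ord_recl big_ord0 /= /bump/= !mul0r sin0 !mul1r expr1 mulr0 add0r addr0.
  by rewrite -mulrA subrr normr0 expr0 divr1 subrr mulr0.
rewrite /sinepoly big_ord_recr/= -/(sinepoly _ _ _) addrAC.
apply: (le_trans (ler_normD _ _)).
have -> : 4 - 4 / 2 ^+ n.+1 = (4 - 4 / 2 ^+ n) + 2 / 2 ^+ n :> R.
  by rewrite exprS; field; rewrite expf_neq0.
rewrite mulrDr; apply: lerD => //.
rewrite normrM -[leRHS]mulr1; apply: ler_pM => //; last exact: sin_max.
rewrite normrM (ger0_norm (exprn_ge0 _ s0)) -addn2 exprD mulrA [leRHS]mulrAC.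
rewrite ler_wpM2r ?sqr_ge0//.
apply: (@le_trans _ _ ((n + 2)%:R * c 1%N * (1 / 4) ^+ n)).
  apply: ler_pM => //; first by rewrite exprn_ge0.
    by apply: ck; rewrite addn2.
  by rewrite lerXn2r ?nnegrE// divr_ge0.
rewrite mulrAC mulrC ler_wpM2l//.
have -> : 1 / 4 = 2^-1 * 2^-1 :> R by field.
rewrite exprMn exprVn mulrA ler_pM2r ?invr_gt0 ?exprn_gt0//.
rewrite ler_pdivrMr ?exprn_gt0// -natrX -natrM ler_nat.
have h : (n.+1 <= 2 ^ n)%N by exact: ltn_expl.
have h1 : (1 <= 2 ^ n)%N by rewrite expn_gt0.
by move: (2 ^ n)%N h h1 => p h h1; rewrite mul2n -addnn addn2 -addn1; exact: leq_add.
Qed.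

(** * Harmonic functions in the plane *)

Section Derivatives.
Context {R : realType}.

(** If [c > 0], then [f' a = 0] makes [f'] positive just to the right of [a], and the mean value
    theorem contradicts maximality. *)
Lemma second_derivative_le0 (f f' : R -> R) (a c : R) :
  (\forall t \near a, is_derive (t : R) (1 : R) f (f' t)) -> is_derive a (1 : R) f' c ->
  (\forall t \near a, f t <= f a) -> c <= 0.
Proof.
move=> df df' fmax; rewrite leNgt; apply/negP => c0.
have [d /= d0 dP] : nbhs a (fun t : R => is_derive t (1 : R) f (f' t) /\ f t <= f a).
  by near=> t; split; near: t.
have dI (t : R) : t \in `]a - d, a + d[ -> ball a d t.
  by rewrite in_itv/= /ball/= distrC ltr_norml => /andP[? ?]; apply/andP; split; lra.
have f'a : f' a = 0.
  have da : is_derive a (1 : R) f 0.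
    apply: (@derive1_at_max _ f (a - d) (a + d)).
    - lra.
    - by move=> t /dI /dP[[]].
    - by rewrite in_itv/=; apply/andP; split; lra.
    - by move=> t /dI /dP[].
  have [da' _] := dP a (ballxx a d0).
  by rewrite -(@derive_val _ _ _ _ _ _ _ da) (@derive_val _ _ _ _ _ _ _ da').
have := @ex_derive _ _ _ _ _ _ _ df'; rewrite /derivable => /cvg_ex[l hl].
have lc : l = c.
  rewrite -(@derive_val _ _ _ _ _ _ _ df') /derive; apply/esym/cvg_lim => //.
rewrite lc in hl.
have [e /= e0 eP] := cvgr_gt _ hl _ c0.
pose b := a + Num.min d e / 2.
have m0 : 0 < Num.min d e by rewrite lt_min d0 e0.
have md : Num.min d e <= d by rewrite ge_min lexx.
have me : Num.min d e <= e by rewrite ge_min lexx orbT.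
have ab : a < b by rewrite /b; lra.
have bd (t : R) : a <= t <= b -> ball a d t.
  by move=> /andP[at_ tb]; apply: dI; rewrite in_itv/=; apply/andP; split; rewrite /b in tb; lra.
have [||xi] := @MVT _ f f' a b ab.
- by move=> t; rewrite in_itv/= => /andP[? ?]; apply: (dP t _).1; apply: bd; rewrite !ltW.
- apply: derivable_within_continuous => t; rewrite in_itv/= => tab.
  by have [[]] := dP t (bd _ tab).
rewrite in_itv/= => /andP[axi xib] E.
have fb : f b <= f a by apply: (dP b _).2; apply: bd; rewrite lexx ltW.
have : 0 < f' xi.
  have /= := eP (xi - a); rewrite /ball_ /= distrC subr0 gtr0_norm ?subr_gt0//.
  have -> : xi - a < e by rewrite /b in xib; lra.
  rewrite gt_eqF ?subr_gt0// => /(_ isT isT).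
  rewrite /GRing.scale/= mulr1 subrK f'a subr0 mulrC pmulr_lgt0// invr_gt0 subr_gt0//.
have : 0 < b - a by rewrite subr_gt0.
by move=> ba xi0; have := mulr_gt0 xi0 ba; rewrite -E; lra.
Unshelve. all: by end_near. Qed.

Lemma is_derive_line (V : normedModType R) (f : V -> R) (x v : V) (t d : R) :
  is_derive (x + t *: v) v f d <-> is_derive t (1 : R) (fun s => f (x + s *: v)) d.
Proof.
have E : (fun h : R => h^-1 *: (f (h *: v + (x + t *: v)) - f (x + t *: v))) =
  (fun h : R => h^-1 *: (f (x + (h *: 1 + t) *: v) - f (x + t *: v))).
  apply/funext => h; congr (_ *: (f _ - _)).
  by rewrite scalerDl -[h *: 1]/(h * 1) mulr1 addrCA.
by split => -[dd ed]; split; move: dd ed; rewrite /derivable /derive /= E.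
Qed.

End Derivatives.

(** * Complex powers as functions of two real variables *)

Section ComplexPowers.
Context {R : realType}.
Implicit Types (k : nat) (x y p q t r : R).

(* Real and imaginary parts of [(x + i y) ^ k]. *)
Fixpoint cpow k x y : R * R :=
  if k is m.+1 then
    (x * (cpow m x y).1 - y * (cpow m x y).2, x * (cpow m x y).2 + y * (cpow m x y).1)
  else (1, 0).

Lemma cpow_polar k r t :
  cpow k (r * cos t) (r * sin t) = (r ^+ k * cos (k%:R * t), r ^+ k * sin (k%:R * t)).
Proof.
elim: k => [|k IH]; first by rewrite /= mul0r cos0 sin0 expr0 mulr1 mulr0.
rewrite /= IH/= -(natr1 k) mulrDl mul1r cosD sinD exprS; congr pair; ring.
Qed.

Lemma is_derive_cpow k x y p q t :
  is_derive t (1 : R) (fun s => (cpow k (x + s * p) (y + s * q)).1)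
    (k%:R * (p * (cpow k.-1 (x + t * p) (y + t * q)).1
             - q * (cpow k.-1 (x + t * p) (y + t * q)).2)) /\
  is_derive t (1 : R) (fun s => (cpow k (x + s * p) (y + s * q)).2)
    (k%:R * (p * (cpow k.-1 (x + t * p) (y + t * q)).2
             + q * (cpow k.-1 (x + t * p) (y + t * q)).1)).
Proof.
have dlin (z w : R) : is_derive t (1 : R) (fun s : R => z + s * w) w.
  have -> : (fun s : R => z + s * w) = cst z + w \*: id.
    by apply/funext => s /=; rewrite mulrC.
  by apply: is_derive_eq; rewrite add0r /GRing.scale/= mulr1.
elim: k => [|k [IH1 IH2]].
  by split; rewrite /= mul0r; exact: is_derive_cst.
(* The recursion for the power, multiplied by [k] so that it also holds at [k = 0], where [k.-1] is
   0 as well. *)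
have kE : k%:R * (cpow k (x + t * p) (y + t * q)).1 =
    k%:R * ((x + t * p) * (cpow k.-1 (x + t * p) (y + t * q)).1 -
       (y + t * q) * (cpow k.-1 (x + t * p) (y + t * q)).2).
  by case: k {IH1 IH2} => [|k]; rewrite ?mul0r.
have kE2 : k%:R * (cpow k (x + t * p) (y + t * q)).2 =
    k%:R * ((x + t * p) * (cpow k.-1 (x + t * p) (y + t * q)).2 +
       (y + t * q) * (cpow k.-1 (x + t * p) (y + t * q)).1).
  by case: k {IH1 IH2 kE} => [|k]; rewrite ?mul0r.
split.
  have := @is_deriveB _ _ _ _ _ _ _ _ _ (is_deriveM (dlin x p) IH1) (is_deriveM (dlin y q) IH2).
  move=> H; apply: (is_derive_eq H); rewrite /GRing.scale/= -natr1.
  set u := (cpow k _ _) in kE kE2 *; set v := cpow k.-1 _ _ in kE kE2 *.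
  transitivity (p * (k%:R * u.1) - q * (k%:R * u.2) + (p * u.1 - q * u.2)); last by ring.
  by rewrite kE kE2; ring.
have := @is_deriveD _ _ _ _ _ _ _ _ _ (is_deriveM (dlin x p) IH2) (is_deriveM (dlin y q) IH1).
move=> H; apply: (is_derive_eq H); rewrite /GRing.scale/= -natr1.
set u := (cpow k _ _) in kE kE2 *; set v := cpow k.-1 _ _ in kE kE2 *.
transitivity (p * (k%:R * u.2) + q * (k%:R * u.1) + (p * u.2 + q * u.1)); last by ring.
by rewrite kE kE2; ring.
Qed.

Variable M : 'M[R]_2.

Definition mrow (i : 'I_2) (z : 'cV[R]_2) : R := (M *m z) i 0.

Lemma mrowE i z : mrow i z = M i 0 * z 0 0 + M i 1 * z 1 0.
Proof.
by rewrite /mrow mxE big_ord_recl big_ord1; congr (_ + M _ _ * z _ _); apply/val_inj.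
Qed.

Lemma mrow_line i j (z : 'cV[R]_2) t :
  mrow i (z + t *: delta_mx j 0) = mrow i z + t * M i j.
Proof. by rewrite /mrow mulmxDr -scalemxAr -colE !mxE. Qed.

Definition mpow k (z : 'cV[R]_2) : R * R := cpow k (mrow 0 z) (mrow 1 z).

Lemma is_derive_mpow k (z : 'cV[R]_2) (j : 'I_2) :
  is_derive z (delta_mx j 0 : 'cV[R]_2) (fun z => (mpow k z).1)
    (k%:R * (M 0 j * (mpow k.-1 z).1 - M 1 j * (mpow k.-1 z).2)) /\
  is_derive z (delta_mx j 0 : 'cV[R]_2) (fun z => (mpow k z).2)
    (k%:R * (M 0 j * (mpow k.-1 z).2 + M 1 j * (mpow k.-1 z).1)).
Proof.
have E s : mpow k (z + s *: delta_mx j 0)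
    = cpow k (mrow 0 z + s * M 0 j) (mrow 1 z + s * M 1 j).
  by rewrite /mpow !mrow_line.
have [H1 H2] := is_derive_cpow k (mrow 0 z) (mrow 1 z) (M 0 j) (M 1 j) 0.
rewrite !mul0r !addr0 in H1 H2.
have z0 : z = z + 0 *: delta_mx j 0 by rewrite scale0r addr0.
split; rewrite {1}z0; apply/is_derive_line.
  by under eq_fun do rewrite E.
by under eq_fun do rewrite E.
Qed.

End ComplexPowers.

(** * Test functions with constant Laplacian, and the Laplacian at a maximum *)

Section Laplacian.
Context {R : realType}.
Implicit Types (F : 'cV[R]_2 -> R) (z : 'cV[R]_2) (L : R).

(** Bundles explicit derivatives along the axes. The Laplacian is a constant [L], which covers both
    the harmonic comparison functions and the quadratic perturbation. *)
Definition has_laplacian F L : Prop :=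
  exists F1 F2 : 'I_2 -> 'cV[R]_2 -> R,
  [/\ forall j z, is_derive z (delta_mx j 0 : 'cV[R]_2) F (F1 j z),
      forall j z, is_derive z (delta_mx j 0 : 'cV[R]_2) (F1 j) (F2 j z) &
      forall z, \sum_j F2 j z = L].

Lemma has_laplacianD F G L K : has_laplacian F L -> has_laplacian G K ->
  has_laplacian (fun z => F z + G z) (L + K).
Proof.
move=> [F1 [F2 [dF dF1 lF]]] [G1 [G2 [dG dG1 lG]]].
exists (fun j z => F1 j z + G1 j z), (fun j z => F2 j z + G2 j z); split.
- by move=> j z; apply: is_deriveD.
- by move=> j z; apply: is_deriveD.
- by move=> z; rewrite big_split/= lF lG.
Qed.

Lemma has_laplacianZ F L a : has_laplacian F L ->
  has_laplacian (fun z => a * F z) (a * L).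
Proof.
move=> [F1 [F2 [dF dF1 lF]]].
exists (fun j z => a * F1 j z), (fun j z => a * F2 j z); split.
- by move=> j z; apply: is_deriveZ.
- by move=> j z; apply: is_deriveZ.
- by move=> z; rewrite -mulr_sumr lF.
Qed.

Lemma has_laplacian_sum n (F : nat -> 'cV[R]_2 -> R) :
  (forall k, has_laplacian (F k) 0) ->
  has_laplacian (fun z => \sum_(k < n) F k z) 0.
Proof.
move=> lF; elim: n => [|n IH].
  have := has_laplacianZ 0 (lF 0%N); rewrite mul0r.
  by congr has_laplacian; apply/funext => z; rewrite mul0r big_ord0.
under eq_fun do rewrite big_ord_recr/=.
by have := has_laplacianD IH (lF n); rewrite addr0.
Qed.

(* The two hypotheses say that [M] is conformal. *)
Lemma has_laplacian_mpow (M : 'M[R]_2) k :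
  M 0 0 ^+ 2 + M 0 1 ^+ 2 = M 1 0 ^+ 2 + M 1 1 ^+ 2 ->
  M 0 0 * M 1 0 + M 0 1 * M 1 1 = 0 ->
  has_laplacian (fun z => (mpow M k z).2) 0.
Proof.
move=> M1 M2.
exists (fun j z => k%:R * (M 0 j * (mpow M k.-1 z).2 + M 1 j * (mpow M k.-1 z).1)).
exists (fun j z => k%:R * (M 0 j * (k.-1%:R * (M 0 j * (mpow M k.-2 z).2 + M 1 j * (mpow M k.-2 z).1))
   + M 1 j * (k.-1%:R * (M 0 j * (mpow M k.-2 z).1 - M 1 j * (mpow M k.-2 z).2)))).
split => [j z|j z|z].
- exact: (is_derive_mpow M k z j).2.
- have [H1 H2] := is_derive_mpow M k.-1 z j.
  by apply: is_deriveZ; apply: is_deriveD; apply: is_deriveZ.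
- rewrite big_ord_recl big_ord1.
  have -> : lift ord0 ord0 = 1 :> 'I_2 by apply/val_inj.
  set I := (mpow M k.-2 z).2; set J := (mpow M k.-2 z).1.
  transitivity (k%:R * k.-1%:R * ((M 0 0 ^+ 2 + M 0 1 ^+ 2 - (M 1 0 ^+ 2 + M 1 1 ^+ 2)) * I +
     2 * (M 0 0 * M 1 0 + M 0 1 * M 1 1) * J)); last by rewrite M1 M2; ring.
  by rewrite -[ord0]/(0 : 'I_2); ring.
Qed.

Lemma has_laplacian_sqr (M : 'M[R]_2) (i : 'I_2) :
  has_laplacian (fun z => mrow M i z ^+ 2) (2 * (M i 0 ^+ 2 + M i 1 ^+ 2)).
Proof.
have dm j z : is_derive z (delta_mx j 0 : 'cV[R]_2) (mrow M i) (M i j).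
  have -> : z = z + 0 *: delta_mx j 0 by rewrite scale0r addr0.
  apply/is_derive_line; under eq_fun do rewrite mrow_line.
  have -> : (fun s : R => mrow M i z + s * M i j) = cst (mrow M i z) + M i j \*: id.
    by apply/funext => s /=; rewrite mulrC.
  by apply: is_derive_eq; rewrite add0r /GRing.scale/= mulr1.
exists (fun j z => 2 * M i j * mrow M i z), (fun j z => 2 * M i j * M i j); split => [j z|j z|z].
- under eq_fun do rewrite expr2.
  by apply: (is_derive_eq (is_deriveM (dm j z) (dm j z))); rewrite /GRing.scale/=; ring.
- exact: is_deriveZ.
- rewrite big_ord_recl big_ord1.
  have -> : lift ord0 ord0 = 1 :> 'I_2 by apply/val_inj.
  by rewrite -[ord0]/(0 : 'I_2); ring.
Qed.

(** The second derivative test along each axis, summed. The factor [s] will be 1 or -1, for the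
    upper and the lower bound on [u]. *)
Lemma local_max_laplacian (A : set 'cV[R]_2) (u : 'cV[R]_2 -> R) s F L x :
  C2_on A^° u -> has_laplacian F L -> A^° x ->
  (forall j : 'I_2, \forall t \near (0 : R), s * u (x + t *: delta_mx j 0) +
     F (x + t *: delta_mx j 0) <= s * u x + F x) ->
  s * laplacian u x + L <= 0.
Proof.
move=> uC2 [F1 [F2 [dF dF1 lF]]] Ax xmax.
rewrite -(lF x) /laplacian mulr_sumr -big_split/= sumr_le0// => j _.
pose e : 'cV[R]_2 := delta_mx j 0.
apply: (@second_derivative_le0 _ (fun t => s * u (x + t *: e) + F (x + t *: e))
  (fun t => s * partial j u (x + t *: e) + F1 j (x + t *: e)) 0).
- have cx : (fun t : R => x + t *: e) @ 0 --> x.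
    rewrite -[X in _ --> X]addr0 -[X in x + X](scale0r e).
    apply: cvgD; first exact: cvg_cst.
    exact: scalel_continuous.
  near=> t; have At : A^° (x + t *: e).
    by near: t; exact: (cx _ (open_nbhs_nbhs (conj (@open_interior _ A) Ax))).
  apply: (is_derive_line (fun z => s * u z + F z) x e t _).1.
  have [du dpu _] := uC2 _ At j j.
  have H1 : is_derive (x + t *: e) e (fun z => s * u z) (s * 'D_e (u) (x + t *: e)).
    exact/is_deriveZ/derivableP.
  exact: is_deriveD H1 _.
- apply: (is_derive_line (fun z => s * partial j u z + F1 j z) x e 0 _).1.
  rewrite scale0r addr0.
  have [du dpu _] := uC2 _ Ax j j.
  have H1 : is_derive (x) e (fun z => s * partial j u z) (s * 'D_e (partial j u) (x)).
    exact/is_deriveZ/derivableP.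
  exact: is_deriveD H1 _.
- by rewrite scale0r addr0; exact: xmax.
Unshelve. all: by end_near. Qed.

End Laplacian.

(** * The sector *)

Lemma within_continuous_comp_sub (U V W : topologicalType) (D : set U) (A : set V)
    (f : U -> V) (g : V -> W) :
  (forall x, D x -> A (f x)) -> continuous f -> {within A, continuous g} ->
  {within D, continuous (g \o f)}.
Proof.
move=> DA cf /subspace_continuousP cg; apply/subspace_continuousP => x Dx.
move=> P nP; have := cf x _ (cg _ (DA _ Dx) P nP).
by apply: (@filterS _ (nbhs x)) => y /= h Dy; apply: h; exact: DA.
Qed.

Lemma ord2P (i : 'I_2) : i = 0 \/ i = 1.
Proof. by case: i => [[|[|//]] h]; [left|right]; exact/val_inj. Qed.

Section Sector.
Context {R : realType}.
Variables (Q : 'M[R]_2) (b : R).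
Hypotheses (Qu : Q \in unitmx) (b0 : 0 < b) (bpi : b < pi).

Let C : set 'cV[R]_2 := [set invmx Q *m y | y in quadrant].

(* [invmx Q *m y] is mapped to the complex number [y_0 + y_1 exp (i b)], so that the
   image of the quadrant is the sector [0 <= arg <= b]. *)
Definition sector_mx : 'M[R]_2 :=
  (\matrix_(i, j) (if i == 0 then (if j == 0 then 1 else cos b)
                   else (if j == 0 then 0 else sin b))) *m Q.

(* The preimage under [sector_mx] of the complex number [r exp (i t)]. *)
Definition sector_pt (r t : R) : 'cV[R]_2 :=
  (r * sin (b - t) / sin b) *: (invmx Q *m delta_mx 0 0)
  + (r * sin t / sin b) *: (invmx Q *m delta_mx 1 0).

Let sb : 0 < sin b. Proof. by rewrite sin_gt0_pi// b0. Qed.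
Let sbN : sin b != 0. Proof. by rewrite gt_eqF. Qed.

Lemma mrow_sector_mx z :
  mrow sector_mx 0 z = mrow Q 0 z + cos b * mrow Q 1 z /\
  mrow sector_mx 1 z = sin b * mrow Q 1 z.
Proof.
rewrite /mrow /sector_mx -!mulmxA ![(_ *m (Q *m z)) _ _]mxE !big_ord_recl !big_ord0.
have -> : lift ord0 ord0 = 1 :> 'I_2 by apply/val_inj.
by rewrite !mxE/= -[ord0]/(0 : 'I_2) mul1r mul0r add0r !addr0.
Qed.

Lemma mrow_sector_pt r t :
  mrow Q 0 (sector_pt r t) = r * sin (b - t) / sin b /\
  mrow Q 1 (sector_pt r t) = r * sin t / sin b.
Proof.
by rewrite /mrow /sector_pt mulmxDr -!scalemxAr !mulKVmx// !mxE/= !mulr1 !mulr0 addr0 add0r.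
Qed.

Lemma mrow_sector r t :
  mrow sector_mx 0 (sector_pt r t) = r * cos t /\
  mrow sector_mx 1 (sector_pt r t) = r * sin t.
Proof.
have [-> ->] := mrow_sector_mx (sector_pt r t); have [-> ->] := mrow_sector_pt r t.
by rewrite sinB; split; field.
Qed.

Lemma mrow_inj (z z' : 'cV[R]_2) : (forall i, mrow Q i z = mrow Q i z') -> z = z'.
Proof.
move=> h; rewrite -[z](mulKmx Qu) -[z'](mulKmx Qu); congr (_ *m _).
by apply/matrixP => i j; rewrite (ord1 j); exact: h.
Qed.

Lemma cone_mrow z : C z <-> forall i, 0 <= mrow Q i z.
Proof.
split => [[y y0 <-] i|h]; first by rewrite /mrow mulKVmx.
by exists (Q *m z) => //; rewrite mulKmx.
Qed.

Lemma continuous_mrow (M : 'M[R]_2) i : continuous (mrow M i).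
Proof.
move=> z; have -> : mrow M i = (fun z => M i 0 * z 0 0 + M i 1 * z 1 0).
  by apply/funext => y; rewrite mrowE.
have c j : (fun z : 'cV[R]_2 => M i j * z j 0) @ z --> M i j * z j 0.
  exact: (cvgM (cvg_cst (M i j)) (@coord_continuous R 2 1 j 0 z)).
exact: cvgD (c 0) (c 1).
Qed.

Lemma cone_interior z : (forall i, 0 < mrow Q i z) -> C^° z.
Proof.
move=> h; pose O := [set z | 0 < mrow Q 0 z] `&` [set z | 0 < mrow Q 1 z].
have oI i : open [set z | 0 < mrow Q i z].
  apply: (@open_comp _ _ (mrow Q i) [set t : R | 0 < t]); last exact: open_gt.
  by move=> ? _; exact: continuous_mrow.
have oO : open O by exact: openI.
rewrite /interior; apply: (@filterS _ _ _ O); last first.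
  by apply: open_nbhs_nbhs; split => //; split; exact: h.
move=> y [h0 h1]; apply/cone_mrow => i.
by case: (ord2P i) => ->; exact: ltW.
Qed.

(** A small move from [z] against the edge vector [invmx Q *m delta_mx i 0] makes the [i]-th
    coordinate negative. *)
Lemma cone_boundary z i : C z -> mrow Q i z = 0 -> boundary C z.
Proof.
move=> Cz z0; split; first exact: subset_closure.
move=> iz; pose v := invmx Q *m (delta_mx i 0 : 'cV[R]_2).
have cz : (fun t : R => z + t *: v) @ 0 --> z.
  rewrite -[X in _ --> X]addr0 -[X in z + X](scale0r v).
  apply: cvgD; first exact: cvg_cst.
  exact: scalel_continuous.
have /nbhs_ballP[e /= e0 eP] : nbhs (0 : R) (fun t => C (z + t *: v)) := cz _ iz.
have /cone_mrow/(_ i) : C (z + (- (e / 2)) *: v).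
  by apply: eP; rewrite /ball/= sub0r opprK gtr0_norm; lra.
rewrite /mrow mulmxDr -scalemxAr mulKVmx// mxE [X in _ + X]mxE.
by rewrite -[(Q *m z) i 0]/(mrow Q i z) z0 mxE !eqxx mulr1; lra.
Qed.


Lemma sector_pt_cone r t : 0 <= r -> 0 <= t <= b -> C (sector_pt r t).
Proof.
move=> r0 /andP[t0 tb]; apply/cone_mrow => i; have [E0 E1] := mrow_sector_pt r t.
have s1 : 0 <= sin (b - t) by apply: sin_ge0_pi; apply/andP; split; move: b0 bpi; lra.
have s2 : 0 <= sin t by apply: sin_ge0_pi; apply/andP; split; move: b0 bpi; lra.
by case: (ord2P i) => ->; rewrite ?E0 ?E1 divr_ge0 ?mulr_ge0// ltW.
Qed.

Lemma sector_pt_interior r t : 0 < r -> 0 < t < b -> C^° (sector_pt r t).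
Proof.
move=> r0 /andP[t0 tb]; apply: cone_interior => i; have [E0 E1] := mrow_sector_pt r t.
have s1 : 0 < sin (b - t) by apply: sin_gt0_pi; apply/andP; split; move: b0 bpi; lra.
have s2 : 0 < sin t by apply: sin_gt0_pi; apply/andP; split; move: b0 bpi; lra.
by case: (ord2P i) => ->; rewrite ?E0 ?E1 divr_gt0 ?mulr_gt0.
Qed.

Lemma sector_pt_boundary r t : 0 <= r -> 0 <= t <= b -> [\/ r = 0, t = 0 | t = b] ->
  boundary C (sector_pt r t).
Proof.
move=> r0 t0 rt; have Cp := sector_pt_cone r0 t0.
have [E0 E1] := mrow_sector_pt r t; case: rt => h.
- by apply: (cone_boundary Cp (i := 0)); rewrite E0 h !mul0r.
- by apply: (cone_boundary Cp (i := 1)); rewrite E1 h sin0 mulr0 mul0r.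
- by apply: (cone_boundary Cp (i := 0)); rewrite E0 h subrr sin0 mulr0 mul0r.
Qed.

Lemma sector_polar z : (forall i, 0 < mrow Q i z) ->
  exists r t, [/\ 0 < r, 0 < t < b, z = sector_pt r t &
    r ^+ 2 = mrow sector_mx 0 z ^+ 2 + mrow sector_mx 1 z ^+ 2].
Proof.
move=> h; have [E0 E1] := mrow_sector_mx z.
set x := mrow sector_mx 0 z in E0 *; set y := mrow sector_mx 1 z in E1 *.
have y0 : 0 < y by rewrite E1 mulr_gt0.
have s0 : 0 < x ^+ 2 + y ^+ 2 by rewrite ltr_wpDl ?sqr_ge0// exprn_gt0.
pose r := Num.sqrt (x ^+ 2 + y ^+ 2).
have r0 : 0 < r by rewrite sqrtr_gt0.
have rN : r != 0 by rewrite gt_eqF.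
have r2 : r ^+ 2 = x ^+ 2 + y ^+ 2 by rewrite sqr_sqrtr// ltW.
have xr : x ^+ 2 < r ^+ 2 by rewrite r2 ltrDl exprn_gt0.
have xr1 : -1 < x / r < 1.
  rewrite -ltr_norml normrM normfV (gtr0_norm r0) ltr_pdivrMr// mul1r.
  by rewrite -(gtr0_norm r0) -ltr_sqr ?nnegrE// !real_normK// num_real.
have xr1' : -1 <= x / r <= 1 by case/andP: xr1 => *; rewrite !ltW.
pose t := acos (x / r).
have t0 : 0 < t by rewrite acos_gt0//; case/andP: xr1 => *; rewrite ltW.
have tpi : t < pi by rewrite acos_ltpi//; case/andP: xr1 => * ; rewrite ltW ?andbT.
have xE : x = r * cos t by rewrite /t acosK ?in_itv//= mulrC divfK.
have yE : y = r * sin t.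
  have st : 0 < sin t by rewrite sin_gt0_pi// t0.
  have : y ^+ 2 = (r * sin t) ^+ 2.
    by rewrite exprMn sin2cos2 mulrBr mulr1 -exprMn -xE r2; ring.
  move/eqP; rewrite eqf_sqr => /orP[/eqP//|/eqP yN].
  by have := mulr_gt0 r0 st; lra.
(* For [t >= b] the coordinate [mrow Q 0 z], which is r sin (b - t) / sin b, would not be
   positive. *)
have tb : t < b.
  rewrite ltNge; apply/negP => bt.
  have : mrow Q 0 z = r * sin (b - t) / sin b.
    have -> : mrow Q 0 z = x - cos b * (y / sin b).
      by rewrite E0 E1; field.
    by rewrite xE yE sinB; field.
  have sn : sin (b - t) <= 0.
    by rewrite -oppr_ge0 -sinN sin_ge0_pi//; apply/andP; split; move: b0 bpi; lra.
  have := h 0 => /[swap] ->; rewrite ltNge.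
  by rewrite pmulr_lle0 ?invr_gt0// pmulr_rle0// sn.
exists r, t; split => //; first by rewrite t0.
apply: mrow_inj => i; have [F0 F1] := mrow_sector_pt r t.
case: (ord2P i) => ->; rewrite ?F0 ?F1.
  have -> : mrow Q 0 z = x - cos b * (y / sin b) by rewrite E0 E1; field.
  by rewrite xE yE sinB; field.
by rewrite -yE E1; field.
Qed.

Lemma continuous_sector_pt : continuous (fun p : R * R => sector_pt p.1 p.2).
Proof.
have c1 (f : R -> R) : continuous f -> continuous (fun p : R * R => f p.1).
  by move=> cf p; apply: (@continuous_comp _ _ _ fst f); [exact: cvg_fst|exact: cf].
have c2 (f : R -> R) : continuous f -> continuous (fun p : R * R => f p.2).
  by move=> cf p; apply: (@continuous_comp _ _ _ snd f); [exact: cvg_snd|exact: cf].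
have cS (f : R -> R) : continuous f -> continuous (fun p : R * R => p.1 * f p.2 / sin b).
  move=> cf p; apply: cvgM; last exact: cvg_cst.
  by apply: cvgM; [exact: cvg_fst|exact: c2].
have cD : continuous (fun t => sin (b - t)).
  move=> t; apply: (@continuous_comp _ _ _ (fun t => b - t) sin).
    by apply: cvgB; [exact: cvg_cst|exact: cvg_id].
  exact: continuous_sin.
by move=> p; apply: cvgD; apply: cvgZr_tmp; [exact: (cS _ cD)|exact: (cS _ (@continuous_sin R))].
Qed.

End Sector.

(** * Uniqueness of the reduite of a sector *)

Section SectorReduite.
Context {R : realType}.
Variables (Q : 'M[R]_2) (b : R) (d : nat).
Hypotheses (Qu : Q \in unitmx) (b0 : 0 < b) (bpi : b < pi) (db : d%:R * b = pi).

Let C : set 'cV[R]_2 := [set invmx Q *m y | y in quadrant].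
Let M := sector_mx Q b.
Let pt := sector_pt Q b.

Hypothesis conf1 : M 0 0 ^+ 2 + M 0 1 ^+ 2 = M 1 0 ^+ 2 + M 1 1 ^+ 2.
Hypothesis conf2 : M 0 0 * M 1 0 + M 0 1 * M 1 1 = 0.

(* The perturbation by [del * mrow M 0 z ^+ 2] makes the function strictly
   subharmonic, so that it has no interior maximum. *)
Lemma sector_maximum_principle (u : 'cV[R]_2 -> R) (s : R) (F : 'cV[R]_2 -> R) (r0 e : R) :
  {within C, continuous u} -> C2_on C^° u -> (forall z, C^° z -> laplacian u z = 0) ->
  continuous F -> has_laplacian F 0 -> 0 < r0 ->
  (forall r t, 0 <= r <= r0 -> 0 <= t <= b -> [\/ r = 0, t = 0, t = b | r = r0] ->
     s * u (pt r t) + F (pt r t) <= e) ->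
  forall r t, 0 <= r <= r0 -> 0 <= t <= b -> s * u (pt r t) + F (pt r t) <= e.
Proof.
move=> cu u2 lu cF lF r00 edge r t r_ t_.
(* The maximum is taken over polar coordinates, where compactness is immediate, instead of over the
   truncated sector. *)
pose K : set (R * R) := `[0, r0]%classic `*` `[0, b]%classic.
have KC (p : R * R) : K p -> C (pt p.1 p.2).
  by case; rewrite /= !in_itv/= => /andP[? ?] ?; apply: sector_pt_cone.
have KN : K !=set0.
  by exists (0, 0); split; rewrite /= in_itv/= lexx ltW.
have cK : compact K by apply: compact_setX; exact: segment_compact.
have cpt := @continuous_sector_pt _ Q b.
suff main del : 0 < del -> s * u (pt r t) + F (pt r t) <= e + del * r0 ^+ 2.
  apply/ler_addgt0Pr => eps eps0.
  have := main (eps / r0 ^+ 2); rewrite divfK ?gt_eqF ?exprn_gt0//.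
  by apply; rewrite divr_gt0 ?exprn_gt0.
move=> del0; pose G z := F z + del * mrow M 0 z ^+ 2.
pose L := 0 + del * (2 * (M 0 0 ^+ 2 + M 0 1 ^+ 2)).
have lG : has_laplacian G L by apply/has_laplacianD/has_laplacianZ/has_laplacian_sqr.
have cG : continuous G.
  move=> z; have cm := @continuous_mrow _ M 0 z.
  have -> : G = (fun z => F z + del * (mrow M 0 z * mrow M 0 z)).
    by apply/funext => y; rewrite /G expr2.
  exact: cvgD (cF z) (cvgM (cvg_cst del) (cvgM cm cm)).
pose w (p : R * R) := s * u (pt p.1 p.2) + G (pt p.1 p.2).
have cw : {within K, continuous w}.
  have c1 := within_continuous_comp_sub KC cpt cu.
  have c2 : {within K, continuous (fun p => G (pt p.1 p.2))}.
    apply: continuous_subspaceT => p.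
    by apply: (@continuous_comp _ _ _ (fun p => pt p.1 p.2) G); [exact: cpt|exact: cG].
  by move=> p; exact: cvgD (cvgM (cvg_cst s) (c1 p)) (c2 p).
have [[r1 t1]] := compact_EVT_max KN cK cw.
rewrite inE => -[/=]; rewrite !in_itv/= => r1_ t1_ wmax.
have Gpt (r' t' : R) : 0 <= r' <= r0 -> F (pt r' t') <= G (pt r' t') <= F (pt r' t') + del * r0 ^+ 2.
  move=> /andP[r'0 r'r]; have [X _] := mrow_sector Qu b0 bpi r' t'.
  apply/andP; split; first by rewrite /G lerDl mulr_ge0 ?sqr_ge0// ltW.
  rewrite /G lerD2l ler_pM2l//.
  have c1 : cos t' ^+ 2 <= 1 by have := cos2Dsin2 t'; have := sqr_ge0 (sin t'); lra.
  have r2 : r' ^+ 2 <= r0 ^+ 2 by rewrite ler_sqr ?nnegrE// ltW.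
  by rewrite X exprMn -[leRHS]mulr1 ler_pM ?sqr_ge0.
have le_w : s * u (pt r t) + F (pt r t) <= w (r1, t1).
  apply: (le_trans _ (wmax (r, t) _)).
    by rewrite /w/= lerD2l; case/andP: (Gpt r t r_).
  by rewrite inE; split; rewrite /= in_itv.
have edge_le : [\/ r1 = 0, t1 = 0, t1 = b | r1 = r0] ->
    s * u (pt r t) + F (pt r t) <= e + del * r0 ^+ 2.
  move=> E; apply: (le_trans le_w); rewrite /w/=.
  have /andP[_ H] := Gpt r1 t1 r1_.
  apply: (le_trans (lerD (lexx _) H)).
  by rewrite addrA lerD2r; exact: edge.
have [/eqP|r1N] := boolP (r1 == 0); first by move=> ?; apply: edge_le; constructor 1.
have [/eqP|t1N] := boolP (t1 == 0); first by move=> ?; apply: edge_le; constructor 2.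
have [/eqP|t1b] := boolP (t1 == b); first by move=> ?; apply: edge_le; constructor 3.
have [/eqP|r1r] := boolP (r1 == r0); first by move=> ?; apply: edge_le; constructor 4.
have {r1N}r10 : 0 < r1 by rewrite lt_def r1N; case/andP: r1_.
have {r1r}r1r0 : r1 < r0 by rewrite lt_def eq_sym r1r; case/andP: r1_.
have {t1N}t10 : 0 < t1 by rewrite lt_def t1N; case/andP: t1_.
have {t1b}t1b : t1 < b by rewrite lt_def eq_sym t1b; case/andP: t1_.
set x := pt r1 t1.
have Cx : C^° x by apply: sector_pt_interior => //; rewrite t10.
exfalso.
have Mpos : 0 < M 0 0 ^+ 2 + M 0 1 ^+ 2.
  rewrite lt_def addr_ge0 ?sqr_ge0// andbT; apply/negP.
  rewrite paddr_eq0 ?sqr_ge0// !sqrf_eq0 => /andP[/eqP M0 /eqP M1].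
  have [X _] := mrow_sector Qu b0 bpi 1 0.
  by move: X; rewrite -/M mrowE M0 M1 !mul0r addr0 cos0 mulr1 => /eqP; rewrite eq_sym oner_eq0.
have := @local_max_laplacian _ C u s G L x u2 lG Cx; rewrite lu// mulr0 add0r.
have L0 : 0 < L by rewrite /L add0r !mulr_gt0.
move=> /(_ _)/wrap[]; last by rewrite leNgt L0.
move=> j; pose v : 'cV[R]_2 := delta_mx j 0.
have cx : (fun t : R => x + t *: v) @ 0 --> x.
  rewrite -[X in _ --> X]addr0 -[X in x + X](scale0r v).
  apply: cvgD; first exact: cvg_cst.
  exact: scalel_continuous.
(* Squared modulus of zeta. Near [x] it stays below [r0 ^+ 2] and the cone coordinates stay
   positive, so nearby points have polar coordinates in [K], where [wmax] applies. *)
pose N z := mrow M 0 z ^+ 2 + mrow M 1 z ^+ 2.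
have cN : continuous N.
  move=> z; have cm i := @continuous_mrow _ M i z.
  have -> : N = (fun z => mrow M 0 z * mrow M 0 z + mrow M 1 z * mrow M 1 z).
    by apply/funext => y; rewrite /N !expr2.
  exact: cvgD (cvgM (cm 0) (cm 0)) (cvgM (cm 1) (cm 1)).
have Nx : N x < r0 ^+ 2.
  rewrite /N; have [-> ->] := mrow_sector Qu b0 bpi r1 t1.
  by rewrite !exprMn -mulrDr cos2Dsin2 mulr1 ltr_sqr ?nnegrE; [exact: r1r0|exact: ltW|exact: ltW].
have near_lt : \forall z \near x, N z < r0 ^+ 2 by exact: (cvgr_lt _ (cN x) _ Nx).
have near_pos i : \forall z \near x, 0 < mrow Q i z.
  apply: (cvgr_gt _ (@continuous_mrow _ Q i x)).
  have [E0 E1] := mrow_sector_pt b Qu r1 t1.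
  have sb : 0 < sin b by rewrite sin_gt0_pi// b0.
  have s1 : 0 < sin (b - t1).
    by apply: sin_gt0_pi; apply/andP; split; move: b0 bpi; lra.
  have s2 : 0 < sin t1 by apply: sin_gt0_pi; apply/andP; split; move: b0 bpi; lra.
  by case: (ord2P i) => ->; rewrite ?E0 ?E1 divr_gt0 ?mulr_gt0.
have near_line i : \forall h \near (0 : R), 0 < mrow Q i (x + h *: v).
  exact: (cx _ (near_pos i)).
near=> h.
have hlt : N (x + h *: v) < r0 ^+ 2 by near: h; exact: (cx _ near_lt).
have hpos i : 0 < mrow Q i (x + h *: v).
  by case: (ord2P i) => ->; near: h; exact: near_line.
have [r2 [t2 [r20 /andP[t20 t2b] zE r2E]]] := sector_polar Qu b0 bpi hpos.
have r2r : r2 <= r0.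
  have r2sq : r2 ^+ 2 <= r0 ^+ 2 by rewrite r2E; exact: ltW.
  by rewrite -ler_sqr ?nnegrE// ltW.
rewrite zE; apply: (wmax (r2, t2)); rewrite inE; split; rewrite /= in_itv/=.
  by rewrite ltW.
by rewrite !ltW.
Unshelve. all: by end_near. Qed.

Let dgt0 : (0 < d)%N.
Proof.
by rewrite lt0n; apply/eqP => d0; have := @pi_gt0 R; rewrite -db d0 mul0r ltxx.
Qed.

Lemma continuous_mpow k : continuous (fun z : 'cV[R]_2 => (mpow M k z).2).
Proof.
suff H : continuous (fun z : 'cV[R]_2 => (mpow M k z).1) /\
    continuous (fun z : 'cV[R]_2 => (mpow M k z).2) by case: H.
elim: k => [|k [IH1 IH2]]; first by split; [exact: (@cst_continuous _ _ (1 : R))|exact: (@cst_continuous _ _ (0 : R))].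
have cm i := @continuous_mrow _ M i.
split=> z.
  exact: cvgB (cvgM (cm 0 z) (IH1 z)) (cvgM (cm 1 z) (IH2 z)).
exact: cvgD (cvgM (cm 0 z) (IH2 z)) (cvgM (cm 1 z) (IH1 z)).
Qed.

Lemma mpow_sector k r t : (mpow M k (pt r t)).2 = r ^+ k * sin (k%:R * t).
Proof.
by rewrite /mpow; have [-> ->] := mrow_sector Qu b0 bpi r t; rewrite cpow_polar.
Qed.

Lemma sin_mul_edge k : sin ((k * d)%:R * b) = 0.
Proof. by rewrite natrM -mulrA db sin_natpi. Qed.

Variable u : 'cV[R]_2 -> R.
Hypothesis ur : is_reduite C u.

Lemma reduite_pt_ge0 r t : 0 <= r -> 0 <= t <= b -> 0 <= u (pt r t).
Proof.
move=> r0 tb; have [_ upos ubd _ _] := ur.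
have [/eqP r00|r0N] := boolP (r == 0).
  by rewrite ubd//; apply: sector_pt_boundary => //; constructor 1.
have [/eqP t00|t0N] := boolP (t == 0).
  by rewrite ubd//; apply: sector_pt_boundary => //; constructor 2.
have [/eqP tb0|tbN] := boolP (t == b).
  by rewrite ubd//; apply: sector_pt_boundary => //; constructor 3.
apply/ltW/upos/sector_pt_interior => //; first by rewrite lt_def r0N.
by case/andP: tb => t0 tb; rewrite !lt_def t0N t0 eq_sym tbN tb.
Qed.

Lemma reduite_approx (r0 e : R) : 0 < r0 -> 0 < e -> exists n c,
  [/\ forall k, (n <= k)%N -> c k = 0,
      forall k, (0 < k)%N -> `|c k| <= k%:R * c 1%N &
      forall r t, 0 <= r <= r0 -> 0 <= t <= b ->
        `|u (pt r t) - sinepoly n (fun k => c k * ((r / r0) ^+ d) ^+ k) (d%:R * t)| <= e].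
Proof.
move=> r00 e0; have [cu upos ubd uC2 ulap] := ur.
have pi0 := @pi_gt0 R; have piN : (pi : R) != 0 by rewrite gt_eqF.
have d0 : (0 : R) < d%:R by rewrite ltr0n.
(* Clamping to [0, pi] before rescaling extends the boundary values on the arc to a continuous
   function on the line that vanishes outside (0, pi), as [sinepoly_approx] requires. *)
pose cl (x : R) := Num.max 0 (Num.min x pi) / d%:R.
have cl01 x : 0 <= cl x <= b.
  have bE : b = pi / d%:R by rewrite -db mulrC mulKf// gt_eqF.
  apply/andP; split; first by rewrite /cl divr_ge0// le_max lexx.
  by rewrite /cl bE ler_pM2r ?invr_gt0// ge_max (ltW pi0) ge_min lexx orbT.
have ccl : continuous cl.
  move=> x; apply: cvgM; last exact: cvg_cst.
  apply: (@continuous_max _ _ (fun=> 0) (fun x => Num.min x pi)); first exact: cvg_cst.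
  by apply: (@continuous_min _ _ id (fun=> pi)); [exact: cvg_id|exact: cvg_cst].
pose g x := u (pt r0 (cl x)).
have cg : continuous g.
  have cpt := @continuous_sector_pt _ Q b.
  have cpt1 : continuous (fun x => pt r0 (cl x)).
    move=> x; apply: (@continuous_comp _ _ _ (fun x => (r0, cl x)) (fun p => pt p.1 p.2)).
      exact: (cvg_pair (cvg_cst r0) (ccl x)).
    exact: cpt.
  apply/(@continuous_subspace_setT R R).
  apply: (within_continuous_comp_sub (A := C) _ cpt1 cu) => x _.
  by apply: sector_pt_cone => //; exact: ltW.
have g0 x : 0 <= g x by apply: reduite_pt_ge0 => //; exact: ltW.
have gout (x : R) : ~ (0 < x < pi) -> g x = 0.
  move=> /negP; rewrite negb_and -!leNgt => h.
  apply: ubd; apply: sector_pt_boundary => //; first exact: ltW.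
  case/orP: h => h; [constructor 2|constructor 3]; rewrite /cl.
    by rewrite max_l ?mul0r// ge_min h.
  by rewrite min_r// max_r ?ltW// -db mulrC mulKf// gt_eqF.
have [n [c [cn Q0 gQ]]] := sinepoly_approx cg g0 gout e0.
exists n, c; split => //; first exact: (sinepoly_coef_le cn Q0).
pose F (z : 'cV[R]_2) := \sum_(k < n) c k * ((r0 ^+ (k * d))^-1 * (mpow M (k * d) z).2).
have cF : continuous F.
  rewrite /F; elim: (n) => [|m IH].
    by under eq_fun do rewrite big_ord0; exact: cst_continuous.
  under eq_fun do rewrite big_ord_recr/=; move=> z.
  exact: cvgD (IH z) (cvgM (cvg_cst _) (cvgM (cvg_cst _) (@continuous_mpow _ z))).
have lF : has_laplacian F 0.
  apply: (@has_laplacian_sum _ n (fun k z => c k * ((r0 ^+ (k * d))^-1 * (mpow M (k * d) z).2))).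
  move=> k; have H := has_laplacian_mpow (k * d) conf1 conf2.
  by have := has_laplacianZ (c k) (has_laplacianZ (r0 ^+ (k * d))^-1 H); rewrite !mulr0.
have Fpt r t : F (pt r t) = sinepoly n (fun k => c k * ((r / r0) ^+ d) ^+ k) (d%:R * t).
  apply: eq_bigr => k _; rewrite mpow_sector natrM -mulrA.
  have -> : ((r / r0) ^+ d) ^+ k = r ^+ (k * d) * (r0 ^+ (k * d))^-1.
    by rewrite -exprM mulnC expr_div_n.
  by rewrite mulrA -!mulrA [_^-1 * (_ * _)]mulrCA.
have edge r t : 0 <= r <= r0 -> 0 <= t <= b -> [\/ r = 0, t = 0, t = b | r = r0] ->
    `|u (pt r t) - F (pt r t)| <= e.
  move=> /andP[r_ _] t_ H.
  have [rr|rN] := eqVneq r r0.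
    rewrite rr Fpt divff ?gt_eqF// expr1n.
    have dt : 0 <= d%:R * t <= pi.
      by rewrite mulr_ge0 ?ler0n ?(andP t_).1//= -db ler_pM2l// (andP t_).2.
    have := gQ _ dt; rewrite /g /cl min_l ?(andP dt).2// max_r ?(andP dt).1//.
    rewrite mulrC mulKf ?gt_eqF//; congr (`|_ - _| <= _).
    by apply: eq_bigr => k _; rewrite expr1n mulr1.
  have {}H : [\/ r = 0, t = 0 | t = b].
    by case: H => [->|->|->|/eqP]; [constructor 1|constructor 2|constructor 3|rewrite (negbTE rN)].
  rewrite ubd; last exact: sector_pt_boundary.
  rewrite /F big1 ?subrr ?normr0 ?ltW// => k _; rewrite mpow_sector.
  case: H => ->; last by rewrite sin_mul_edge !mulr0.
    (* At the apex the power [0 ^+ (k * d)] is 1 for [k = 0], but then the sine vanishes. *)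
    case: (val k) => [|j]; first by rewrite mul0n mul0r sin0 !mulr0.
    by rewrite expr0n muln_eq0 (gtn_eqF dgt0) !mul0r !mulr0.
  by rewrite mulr0 sin0 !mulr0.
have cFN : continuous (fun z => -1 * F z) by move=> z; exact: cvgM (cvg_cst _) (cF z).
have lFN : has_laplacian (fun z => -1 * F z) 0.
  by have := has_laplacianZ (-1) lF; rewrite mulr0.
move=> r t r_ t_; rewrite -Fpt ler_norml; apply/andP; split.
  have := @sector_maximum_principle u (-1) F r0 e cu uC2 ulap cF lF r00.
  move=> /(_ _ r t r_ t_)/wrap[|]; last by lra.
  by move=> r' t' r'_ t'_ /(edge r' t' r'_ t'_); rewrite ler_norml => /andP[? ?]; lra.
have := @sector_maximum_principle u 1 _ r0 e cu uC2 ulap cFN lFN r00.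
move=> /(_ _ r t r_ t_)/wrap[|]; last by lra.
by move=> r' t' r'_ t'_ /(edge r' t' r'_ t'_); rewrite ler_norml => /andP[? ?]; lra.
Qed.

(** The approximating coefficients depend on the radius of the arc. Comparing the approximation at
    the given point with the one at the middle of the unit arc, where the sine is 1, eliminates the
    leading coefficient in favour of [U]. *)
Theorem reduite_sector : exists2 kappa, 0 < kappa &
  forall r t, 0 <= r -> 0 <= t <= b -> u (pt r t) = kappa * (r ^+ d * sin (d%:R * t)).
Proof.
have [cu upos ubd uC2 ulap] := ur.
set U := u (pt 1 (b / 2)).
have U0 : 0 < U.
  by apply: upos; apply: sector_pt_interior => //; apply/andP; split; move: b0 bpi; lra.
exists U => // r t r_ t_; set rho := r ^+ d.
have rho0 : 0 <= rho by rewrite exprn_ge0.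
set A := u (pt r t) - U * (rho * sin (d%:R * t)).
(* The part [1 + rho] collects the two approximation errors, the rest the two tails, with the
   leading coefficient bounded by [2 * (U + 1)]. *)
pose K := 1 + rho + 8 * (U + 1) * (rho ^+ 2 + rho).
have K0 : 0 <= K by rewrite /K; nra.
suff main e : 0 < e -> e <= 1 -> `|A| <= e * K.
  apply/eqP; rewrite -subr_eq0 -normr_le0 leNgt; apply/negP => A0.
  have D0 : 0 < 2 * K + `|A| + 1 by lra.
  have q0 : 0 < `|A| / (2 * K + `|A| + 1) by rewrite divr_gt0.
  have q1 : `|A| / (2 * K + `|A| + 1) <= 1 by rewrite ler_pdivrMr// mul1r; lra.
  have := main _ q0 q1; rewrite mulrAC ler_pdivlMr//; nra.
(* The arc must be beyond [r], the ratios in [sinepoly_tail] at most 1/4 at both points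
   ([8 + 4 * rho]), and [X^-1] at most [e] and 1/8. *)
move=> e0 e1; pose r0 := 8 + 4 * rho + e^-1 + r.
have ei : 0 < e^-1 by rewrite invr_gt0.
have r00 : 1 <= r0 by rewrite /r0; lra.
have [n [c [cn ck uc]]] := reduite_approx (lt_le_trans ltr01 r00) e0.
have c1 : 0 <= c 1%N by have := le_trans (normr_ge0 _) (ck 1%N isT); rewrite mul1r.
pose X := r0 ^+ d.
have Xr0 : r0 <= X by rewrite /X; case: (d) dgt0 => // d' _; rewrite exprS ler_peMr ?exprn_ege1//; lra.
have X0 : 0 < X by lra.
pose m := c 1%N / X.
have m0 : 0 <= m by rewrite divr_ge0// ltW.
have cE : c 1%N = m * X by rewrite /m divfK// gt_eqF.
have approx (r' t' : R) : 0 <= r' -> r' ^+ d <= rho \/ r' ^+ d <= 1 -> r' <= r0 -> 0 <= t' <= b ->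
   `|u (pt r' t') - m * (r' ^+ d * sin (d%:R * t'))| <= e + 4 * m * (r' ^+ d) ^+ 2 / X.
  move=> r'0 r'd r'r t'_.
  have s0 : 0 <= (r' / r0) ^+ d <= 1 / 4.
    rewrite exprn_ge0 ?divr_ge0//=; last lra.
    rewrite expr_div_n ler_pdivrMr// -/X; case: r'd => h; rewrite /r0 in Xr0; lra.
  have r'_ : 0 <= r' <= r0 by rewrite r'0.
  have H1 := uc r' t' r'_ t'_.
  have H2 := sinepoly_tail (d%:R * t') cn ck s0.
  have E1 : c 1%N * ((r' / r0) ^+ d * sin (d%:R * t')) = m * (r' ^+ d * sin (d%:R * t')).
    by rewrite /m expr_div_n -/X; field; rewrite gt_eqF.
  have E2 : 4 * c 1%N * ((r' / r0) ^+ d) ^+ 2 = 4 * m * (r' ^+ d) ^+ 2 / X.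
    by rewrite /m expr_div_n -/X; field; rewrite gt_eqF.
  rewrite E1 E2 in H2.
  move: H1 H2; set q := sinepoly _ _ _ => H1 H2.
  rewrite -(subrK q (u _)) -addrA.
  by apply: (le_trans (ler_normD _ _)); apply: lerD.
have b2 : 0 <= b / 2 <= b by apply/andP; split; move: b0; lra.
have H1 : `|U - m| <= e + 4 * m / X.
  have e1' : (1 : R) ^+ d <= 1 by rewrite expr1n.
  have := approx 1 (b / 2) ler01 (or_intror e1') r00 b2.
  rewrite expr1n.
  have -> : d%:R * (b / 2) = pi / 2 by rewrite mulrA db.
  by rewrite sin_pihalf expr1n !mulr1.
have H2 := approx r t r_ (or_introl (lexx _)) _ t_.
have {}H2 : `|u (pt r t) - m * (rho * sin (d%:R * t))| <= e + 4 * m * rho ^+ 2 / X.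
  by apply: H2; rewrite /r0; lra.
have Xi : X^-1 <= e.
  rewrite -[leRHS]invrK lef_pV2 ?posrE//; rewrite /r0 in Xr0; lra.
have X8 : X^-1 <= 1 / 8.
  by rewrite div1r lef_pV2 ?posrE//; rewrite /r0 in Xr0; lra.
have Xi0 : 0 < X^-1 by rewrite invr_gt0.
(* From [e <= 1] and [X^-1 <= 1 / 8] one gets m <= U + 1 + m / 2. *)
have mU : m <= 2 * (U + 1).
  move: H1; rewrite ler_norml => /andP[h _].
  by have : m * X^-1 <= m * (1 / 8) by [apply: ler_wpM2l]; lra.
have sn : `|sin (d%:R * t)| <= 1 by exact: sin_max.
have H3 : `|m * (rho * sin (d%:R * t)) - U * (rho * sin (d%:R * t))| <= rho * (e + 4 * m / X).
  rewrite -mulrBl normrM [leRHS]mulrC; apply: ler_pM => //; first by rewrite distrC.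
  by rewrite normrM ger0_norm// ler_piMr.
have -> : A = (u (pt r t) - m * (rho * sin (d%:R * t))) +
   (m * (rho * sin (d%:R * t)) - U * (rho * sin (d%:R * t))) by rewrite /A; ring.
apply: (le_trans (ler_normD _ _)); apply: (le_trans (lerD H2 H3)).
have mX : m * X^-1 <= 2 * (U + 1) * e by apply: ler_pM => //; exact: ltW.
have -> : e + 4 * m * rho ^+ 2 / X + rho * (e + 4 * m / X) =
  e * (1 + rho) + 4 * (m * X^-1) * (rho ^+ 2 + rho) by ring.
have q0 : 0 <= rho ^+ 2 + rho by rewrite addr_ge0// sqr_ge0.
have := ler_wpM2r q0 mX; rewrite /K; nra.
Qed.

End SectorReduite.

(** * The dominant term of a discrete harmonic polynomial *)

Section BivariatePolynomials.
Context {R : realType}.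
Implicit Types (c : nat -> nat -> R) (d : nat) (x y : R).

Definition bipoly c d x y : R :=
  \sum_(i < d.+1) \sum_(j < d.+1) c i j * x ^+ i * y ^+ j.

Definition top_form c d x y : R :=
  \sum_(k < d.+1) c (d - k)%N k * x ^+ (d - k) * y ^+ k.

Lemma sum_antidiagonal d (g : nat -> nat -> R) :
  \sum_(i < d.+1) \sum_(j < d.+1) (if (i + j == d)%N then g i j else 0)
  = \sum_(k < d.+1) g (d - k)%N k.
Proof.
rewrite exchange_big/=; apply: eq_bigr => j _.
have jd : (d - j < d.+1)%N by rewrite ltnS leq_subr.
have jd' : (j <= d)%N by rewrite -ltnS.
rewrite (bigD1 (Ordinal jd))//= subnK// eqxx big1 ?addr0// => i /negbTE ij.
rewrite ifF//; apply: contraFF ij => /eqP ij.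
apply/eqP/val_inj => /=; have := congr1 (subn^~ j) ij; by rewrite /= addnK.
Qed.

(** Replaces multinomials by an array of coefficients indexed by two exponents, on which the
    recurrence for the dominant term can be written. *)
Lemma mpoly_bipoly (P : mpoly 2 R) : exists d c,
  [/\ forall i j, (d < i + j)%N -> c i j = 0,
      forall z, peval P z = bipoly c d (z 0 0) (z 1 0) &
      forall z, peval (dominant_term P) z = top_form c d (z 0 0) (z 1 0)].
Proof.
set d := (mmeasure mdeg P).-1.
pose c i j : R := \sum_(m <- msupp P | (m 0 == i) && (m 1 == j)) mcoeff m P.
have mdegE2 (m : multinom 2) : mdeg m = (m (0%R : 'I_2) + m (1%R : 'I_2))%N.
  rewrite mdegE big_ord_recl big_ord1.
  by congr (m _ + m _)%N; apply/val_inj.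
have mle (m : multinom 2) : m \in msupp P -> (mdeg m <= d)%N.
  by move=> /(mmeasure_mnm_lt mdeg); rewrite /d; case: (mmeasure _ _).
have evE (v : 'I_2 -> R) (m : multinom 2) : \prod_i v i ^+ m i = v 0 ^+ m 0 * v 1 ^+ m 1.
  rewrite big_ord_recl big_ord1.
  by congr (v _ ^+ m _ * v _ ^+ m _); apply/val_inj.
exists d, c; split.
- move=> i j dij; rewrite /c big1_seq// => m /andP[/andP[/eqP mi /eqP mj] mP].
  by have := mle m mP; rewrite mdegE2 mi mj leqNgt dij.
- move=> z; rewrite /peval mevalE /bipoly /c.
  transitivity (\sum_(i < d.+1) \sum_(j < d.+1) \sum_(m <- msupp P)
     (if (m 0 == i :> nat) && (m 1 == j :> nat) then mcoeff m P * (z 0 0 ^+ i * z 1 0 ^+ j) else 0)).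
    under [RHS]eq_bigr do rewrite exchange_big/=.
    rewrite [RHS]exchange_big/= big_seq [RHS]big_seq; apply: eq_bigr => m mP.
    have := mle m mP; rewrite mdegE2 => md.
    have m0 : (m (0%R : 'I_2) < d.+1)%N by rewrite ltnS (leq_trans _ md)// leq_addr.
    have m1 : (m (1%R : 'I_2) < d.+1)%N by rewrite ltnS (leq_trans _ md)// leq_addl.
    rewrite (bigD1 (Ordinal m0))//= (bigD1 (Ordinal m1))//= !eqxx/= evE.
    rewrite big1 ?addr0; last first.
      by move=> j /negbTE jm; rewrite eq_sym ifF//; apply: contraFF jm => jm; rewrite -val_eqE.
    rewrite big1 ?addr0// => i /negbTE im; rewrite big1// => j _.
    rewrite ifF//; apply: contraFF im => /andP[im _].
    by rewrite -val_eqE/= eq_sym.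
  apply: eq_bigr => i _; apply: eq_bigr => j _.
  by rewrite -big_mkcond/= -mulrA mulr_suml.
- move=> z; rewrite /peval /dominant_term /pihomog -/d /top_form /c.
  rewrite raddf_sum/=.
  transitivity (\sum_(k < d.+1) \sum_(m <- msupp P)
     (if (m 0 == (d - k)%N :> nat) && (m 1 == k :> nat)
      then mcoeff m P * (z 0 0 ^+ (d - k) * z 1 0 ^+ k) else 0)).
    rewrite [RHS]exchange_big/= big_mkcond/= big_seq [RHS]big_seq; apply: eq_bigr => m mP.
    have := mle m mP; case: eqVneq => [md _|md _]; last first.
      rewrite big1// => k _; case: ifP => // /andP[/eqP m0 /eqP m1].
      by move: md; rewrite mdegE2 m0 m1 subnK ?eqxx// -ltnS.
    rewrite mdegE2 in md.
    have m1 : (m (1%R : 'I_2) < d.+1)%N by rewrite ltnS -md leq_addl.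
    have m0 : (d - m (1%R : 'I_2) = m (0%R : 'I_2))%N by rewrite -md addnK.
    rewrite (bigD1 (Ordinal m1))//= m0 !eqxx/= mevalZ mevalX evE.
    rewrite big1 ?addr0//.
    move=> j /negbTE jm; rewrite ifF//; apply: contraFF jm => /andP[_ jm].
    by rewrite -val_eqE/= eq_sym.
  apply: eq_bigr => k _.
  by rewrite -big_mkcond/= -mulrA mulr_suml.
Qed.

Lemma poly_eq0_pos (p : {poly R}) : (forall x, 0 < x -> p.[x] = 0) -> p = 0.
Proof.
move=> p0; apply/eqP; apply: contraT => pN.
pose s := [seq k.+1%:R : R | k <- iota 0 (size p)].
have := @max_poly_roots _ p s pN.
have -> : all (root p) s.
  by apply/allP => x /mapP[k _ ->]; rewrite /root p0.
have -> : uniq s.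
  rewrite map_inj_uniq ?iota_uniq// => k l /eqP.
  by rewrite eqr_nat => /eqP[].
by move=> /(_ isT isT); rewrite size_map size_iota ltnn.
Qed.

Lemma bipoly_axes c d : (forall i j, (d < i + j)%N -> c i j = 0) ->
  (forall x, 0 < x -> bipoly c d x 0 = 0) -> (forall y, 0 < y -> bipoly c d 0 y = 0) ->
  (forall i, c i 0%N = 0) /\ (forall j, c 0%N j = 0).
Proof.
move=> cd hx hy; split => k.
  have [kd|dk] := leqP k d; last by apply: cd; rewrite addn0.
  have : (\poly_(i < d.+1) c i 0%N) = 0.
    apply: poly_eq0_pos => x x0; rewrite horner_poly -[RHS](hx x x0); apply: eq_bigr => i _.
    rewrite big_ord_recl/= expr0 mulr1 big1 ?addr0// => j _.
    by rewrite expr0n mulr0.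
  by move=> /(congr1 (fun p : {poly R} => p`_k)); rewrite coef_poly ltnS kd coef0.
have [kd|dk] := leqP k d; last by apply: cd; rewrite add0n.
have : (\poly_(j < d.+1) c 0%N j) = 0.
  apply: poly_eq0_pos => y y0; rewrite horner_poly -[RHS](hy y y0).
  rewrite /bipoly [RHS]big_ord_recl [X in _ = _ + X]big1 ?addr0; last first.
    by move=> i _; rewrite big1// => j _; rewrite expr0n mulr0 mul0r.
  by apply: eq_bigr => i _; rewrite expr0 mulr1.
by move=> /(congr1 (fun p : {poly R} => p`_k)); rewrite coef_poly ltnS kd coef0.
Qed.

Lemma coef_linear_exp (x s : R) n k :
  ((x%:P + s *: 'X) ^+ n)`_k = 'C(n, k)%:R * x ^+ (n - k) * s ^+ k.
Proof.
rewrite exprDn coef_sum.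
have E (i : 'I_n.+1) : (x%:P ^+ (n - i) * (s *: 'X) ^+ i *+ 'C(n, i))`_k =
    if i == k :> nat then 'C(n, k)%:R * x ^+ (n - k) * s ^+ k else 0.
  rewrite coefMn exprZn -rmorphXn/= coefCM coefZ coefXn eq_sym.
  case: eqVneq => [->|]; last by rewrite !mulr0 mul0rn.
  by rewrite mulr1 -mulr_natl; ring.
rewrite (eq_bigr _ (fun i _ => E i)).
have [kn|nk] := leqP k n.
  rewrite (bigD1 (Ordinal (kn : (k < n.+1)%N)))//= eqxx big1 ?addr0// => i ik.
  by rewrite ifF//; apply: contraNF ik => /eqP ik; apply/eqP/val_inj.
rewrite bin_small// !mul0r big1// => i _; case: ifP => // /eqP ik.
Qed.

(** * The second order part of the discrete Laplace equation *)

Section Harmonic.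
Variables (I : Type) (r : seq I) (a s0 s1 : I -> R) (c : nat -> nat -> R) (d : nat).
Hypothesis cd : forall i j, (d < i + j)%N -> c i j = 0.
Hypothesis a1 : \sum_(i <- r) a i = 1.
Hypothesis as0 : \sum_(i <- r) a i * s0 i = 0.
Hypothesis as1 : \sum_(i <- r) a i * s1 i = 0.
Hypothesis harm : forall x y, 0 < x -> 0 < y ->
  \sum_(i <- r) a i * bipoly c d (x + s0 i) (y + s1 i) - bipoly c d x y = 0.

Let M00 := \sum_(i <- r) a i * s0 i * s0 i.
Let M01 := \sum_(i <- r) a i * s0 i * s1 i.
Let M11 := \sum_(i <- r) a i * s1 i * s1 i.
Let h k := c (d - k)%N k.

(* Coefficient of [e ^ 2] in [e ^ d * L P (1 / e, y / e)]. *)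
Lemma harmonic_top_form y : 0 < y ->
  \sum_(k < d.+1) h k * (M00 * 'C(d - k, 2)%:R * y ^+ k
    + M01 * ((d - k) * k)%:R * y ^+ k.-1 + M11 * 'C(k, 2)%:R * y ^+ (k - 2)) = 0.
Proof.
move=> y0.
(* With e the indeterminate, this is e ^ (i + j) times the monomial at the shifted point (1 / e + s0
   x, y / e + s1 x). *)
pose mono (x : I) i j : {poly R} := (1%:P + s0 x *: 'X) ^+ i * (y%:P + s1 x *: 'X) ^+ j.
pose q i j : {poly R} := \sum_(x <- r) a x *: mono x i j - (y ^+ j)%:P.
pose G : {poly R} := \sum_(i < d.+1) \sum_(j < d.+1) c i j *: ('X^(d - (i + j)) * q i j).
have G0 : G = 0.
  apply: poly_eq0_pos => e e0.
  have eN : e != 0 by rewrite gt_eqF.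
  have := harm (x := e^-1) (y := y / e); rewrite invr_gt0 divr_gt0// => /(_ e0 isT).
  move/(congr1 (fun t => e ^+ d * t)); rewrite mulr0 => {1}<-.
  rewrite mulrBr mulr_sumr /bipoly.
  under [in RHS]eq_bigr do rewrite mulrCA mulr_sumr mulr_sumr.
  rewrite exchange_big/= [X in _ = _ - X]mulr_sumr -sumrB horner_sum.
  apply: eq_bigr => i _; rewrite mulr_sumr.
  under [in RHS]eq_bigr do rewrite mulr_sumr mulr_sumr.
  rewrite exchange_big/= -sumrB horner_sum; apply: eq_bigr => j _.
  have [dij|ijd] := ltnP d (i + j).
    rewrite cd// scale0r horner0 big1 ?sub0r; first by rewrite !mul0r mulr0 oppr0.
    by move=> x _; rewrite !mul0r !mulr0.
  rewrite hornerZ hornerM hornerXn /q hornerD hornerN hornerC horner_sum !mulrBr mulr_sumr mulr_sumr.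
  have ed : e ^+ d = e ^+ (d - (i + j)) * e ^+ i * e ^+ j by rewrite -mulrA -!exprD subnK.
  congr (_ - _); last first.
    rewrite ed exprMn exprVn exprVn; field.
    by rewrite !expf_neq0.
  apply: eq_bigr => x _; rewrite hornerZ /mono hornerM !horner_exp !(hornerD, hornerC, hornerZ, hornerX).
  have -> : 1 + s0 x * e = e * (e^-1 + s0 x) by rewrite mulrDr divff// mulrC.
  have -> : y + s1 x * e = e * (y / e + s1 x) by rewrite mulrDr mulrCA divff// mulr1 [s1 x * e]mulrC.
  rewrite ed !exprMn; move: (e^-1 + s0 x) (y / e + s1 x) => A B; ring.
have monoE (x : I) i j k : (mono x i j)`_k = \sum_(l < k.+1)
   ('C(i, l)%:R * s0 x ^+ l) * ('C(j, k - l)%:R * y ^+ (j - (k - l)) * s1 x ^+ (k - l)).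
  rewrite coefM; apply: eq_bigr => l _.
  by rewrite !coef_linear_exp expr1n mulr1.
(* Order 0 vanishes by total mass 1 and order 1 by zero mean. Hence only the terms with [i + j = d]
   reach the coefficient of e ^ 2 in [G]. *)
have q0 i j : (q i j)`_0 = 0.
  rewrite /q coefB coefC eqxx coef_sum.
  under eq_bigr do rewrite coefZ monoE big_ord1 !bin0 !expr0 !mul1r !mulr1 subn0.
  by rewrite -mulr_suml a1 mul1r subrr.
have q1 i j : (q i j)`_1 = 0.
  rewrite /q coefB coefC/= subr0 coef_sum.
  under eq_bigr do rewrite coefZ monoE big_ord_recl big_ord1/= /bump/= !bin0 !bin1 !expr0 !expr1 !mul1r ?mulr1 subn0.
  transitivity ((\sum_(x <- r) a x * s1 x) * (j%:R * y ^+ (j - 1)) +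
    (\sum_(x <- r) a x * s0 x) * (i%:R * y ^+ j)); last by rewrite as0 as1 !mul0r addr0.
  rewrite !mulr_suml -big_split/=; apply: eq_bigr => x _; rewrite subn0; ring.
have q2 i j : (q i j)`_2 = M00 * 'C(i, 2)%:R * y ^+ j + M01 * (i * j)%:R * y ^+ j.-1
    + M11 * 'C(j, 2)%:R * y ^+ (j - 2).
  rewrite /q coefB coefC/= subr0 coef_sum /M00 /M01 /M11 !mulr_suml -!big_split/=.
  apply: eq_bigr => x _.
  rewrite coefZ monoE big_ord_recl big_ord_recl big_ord1/= /bump/= !bin0 !bin1 !expr0 !expr1 !mul1r.
  rewrite ?(subn0, subnn, bin0, subn1) natrM.
  ring.
have := congr1 (fun p : {poly R} => p`_2) G0; rewrite coef0 /G coef_sum => E.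
rewrite -[RHS]E {E}.
transitivity (\sum_(i < d.+1) \sum_(j < d.+1) if (i + j == d)%N then c i j * (q i j)`_2 else 0);
  last first.
  apply: eq_bigr => i _; rewrite coef_sum; apply: eq_bigr => j _.
  rewrite coefZ coefXnM; case: (ltngtP (i + j)%N d) => [ijd|dij|ijd].
  - have := ijd; rewrite -subn_gt0.
    by case: (d - (i + j))%N => [|[|[|n]]]//= _; rewrite ?q1 ?q0 mulr0.
  - by rewrite cd// mul0r.
  - by rewrite ijd subnn.
rewrite (sum_antidiagonal d (fun i j => c i j * (q i j)`_2)).
by apply: eq_bigr => k _; rewrite q2.
Qed.

(** Coefficient form of the equation M00 H_xx / 2 + M01 H_xy + M11 H_yy / 2 = 0, read off at x ^ (d
    - 2 - k) y ^ k. *)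
Lemma harmonic_recurrence k : (k.+2 <= d)%N ->
  M00 * 'C(d - k, 2)%:R * h k + M01 * ((d - k.+1) * k.+1)%:R * h k.+1
  + M11 * 'C(k.+2, 2)%:R * h k.+2 = 0.
Proof.
move=> kd.
(* The truncated exponents [k.-1] and [k - 2] do no harm: where they truncate, the factors
   [(d - k) * k] and ['C(k, 2)] are 0. *)
pose p : {poly R} := \sum_(k < d.+1) (h k * (M00 * 'C(d - k, 2)%:R)) *: 'X^k
    + \sum_(k < d.+1) (h k * (M01 * ((d - k) * k)%:R)) *: 'X^(k.-1)
    + \sum_(k < d.+1) (h k * (M11 * 'C(k, 2)%:R)) *: 'X^(k - 2).
have p0 : p = 0.
  apply: poly_eq0_pos => y y0; rewrite -[RHS](harmonic_top_form y0) /p !hornerD !horner_sum -!big_split/=.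
  by apply: eq_bigr => j _; rewrite !hornerZ !hornerXn; ring.
have := congr1 (fun p : {poly R} => p`_k) p0; rewrite coef0 /p !coefD !coef_sum => E.
rewrite -[RHS]E.
have k0 : (k < d.+1)%N by rewrite ltnS ltnW// ltnW.
have k1 : (k.+1 < d.+1)%N by rewrite ltnS ltnW.
have k2 : (k.+2 < d.+1)%N by rewrite ltnS.
congr (_ + _ + _).
- rewrite (bigD1 (Ordinal k0))//= coefZ coefXn eqxx mulr1 big1 ?addr0 1?mulrC// => i ik.
  rewrite coefZ coefXn; case: eqVneq => [ki|]; last by rewrite mulr0.
  by move: ik; rewrite -val_eqE/= ki eqxx.
- rewrite (bigD1 (Ordinal k1))//= coefZ coefXn eqxx mulr1 big1 ?addr0 1?mulrC// => i ik.
  rewrite coefZ coefXn; case: eqVneq => [ki|]; last by rewrite mulr0.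
  have [i0|i0] := posnP i; first by rewrite i0 muln0 !mulr0 mul0r.
  by move: ik; rewrite -val_eqE/= ki prednK// eqxx.
- rewrite (bigD1 (Ordinal k2))//= coefZ coefXn subn2/= eqxx mulr1 big1 ?addr0 1?mulrC// => i ik.
  rewrite coefZ coefXn; case: eqVneq => [ki|]; last by rewrite mulr0.
  have [i0|i0] := ltnP i 2; first by rewrite bin_small// !mulr0 mul0r.
  by move: ik; rewrite -val_eqE/= ki -addn2 subnK// eqxx.
Qed.

End Harmonic.
End BivariatePolynomials.

(** * Solution of the recurrence and determination of the angle *)

Section TopForm.
Context {R : realType}.
Implicit Types (c : nat -> nat -> R) (d : nat) (x y : R).

(** Pascal's rule: a factor [x] keeps the weights [g] and a factor [z] shifts them. For weights exp
    (i k b) this is multiplication by x + z exp (i b). *)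
Lemma binomial_sum_rec n x z (g : nat -> R) :
  \sum_(k < n.+2) 'C(n.+1, k)%:R * x ^+ (n.+1 - k) * z ^+ k * g k =
  x * (\sum_(k < n.+1) 'C(n, k)%:R * x ^+ (n - k) * z ^+ k * g k) +
  z * (\sum_(k < n.+1) 'C(n, k)%:R * x ^+ (n - k) * z ^+ k * g k.+1).
Proof.
rewrite big_ord_recl/= bin0 subn0.
under eq_bigr do rewrite /bump/= add1n subSS binS natrD !mulrDl.
rewrite big_split/= addrA; congr (_ + _).
  rewrite big_ord_recr/= bin_small// !mul0r addr0.
  rewrite [in RHS]big_ord_recl/= bin0 subn0 mulrDr; congr (_ + _).
    by rewrite exprS; ring.
  rewrite mulr_sumr; apply: eq_bigr => k _; rewrite /bump/= add1n.
  have -> : (n - k = (n - k.+1).+1)%N by rewrite subnSK.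
  by rewrite exprS; ring.
by rewrite mulr_sumr; apply: eq_bigr => k _; rewrite exprS; ring.
Qed.

Lemma cpow_binomial n x z b : cpow n (x + z * cos b) (z * sin b) =
  (\sum_(k < n.+1) 'C(n, k)%:R * x ^+ (n - k) * z ^+ k * cos (k%:R * b),
   \sum_(k < n.+1) 'C(n, k)%:R * x ^+ (n - k) * z ^+ k * sin (k%:R * b)).
Proof.
elim: n => [|n IH].
  by rewrite !big_ord1/= bin0 subnn !expr0 !mul1r mul0r cos0 sin0.
rewrite (binomial_sum_rec n x z (fun k => cos (k%:R * b))).
rewrite (binomial_sum_rec n x z (fun k => sin (k%:R * b))) /= IH/=.
set X := \sum_(k < _) _; set Y := \sum_(k < _) _.
have -> : \sum_(k < n.+1) 'C(n, k)%:R * x ^+ (n - k) * z ^+ k * cos (k.+1%:R * b)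
    = cos b * X - sin b * Y.
  rewrite !mulr_sumr -sumrB; apply: eq_bigr => k _.
  by rewrite -(natr1 k) mulrDl mul1r cosD; ring.
have -> : \sum_(k < n.+1) 'C(n, k)%:R * x ^+ (n - k) * z ^+ k * sin (k.+1%:R * b)
    = cos b * Y + sin b * X.
  rewrite !mulr_sumr -big_split/=; apply: eq_bigr => k _.
  by rewrite -(natr1 k) mulrDl mul1r sinD; ring.
by congr pair; ring.
Qed.

(** The recurrence has order two and its initial term is 0, so the coefficients are fixed by the one
    at [k = 1], from which [kappa] is read off. The closed form satisfies it because sin ((k + 2) b)
    = 2 cos b sin ((k + 1) b) - sin (k b). *)
Lemma top_form_cpow c d (M00 M01 M11 l b : R) :
  0 < l -> 0 < b < pi -> 0 < M11 -> M00 = M11 * l ^+ 2 -> M01 = - (M11 * l * cos b) ->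
  c d 0%N = 0 ->
  (forall k, (k.+2 <= d)%N ->
     M00 * 'C(d - k, 2)%:R * c (d - k)%N k
     + M01 * ((d - k.+1) * k.+1)%:R * c (d - k.+1)%N k.+1
     + M11 * 'C(k.+2, 2)%:R * c (d - k.+2)%N k.+2 = 0) ->
  exists kappa, (forall k, (k <= d)%N ->
      c (d - k)%N k = 'C(d, k)%:R * kappa * l ^+ k * sin (k%:R * b)) /\
    forall x y, top_form c d x y = kappa * (cpow d (x + l * y * cos b) (l * y * sin b)).2.
Proof.
move=> l0 b0 M0 E00 E01 cd0 rec.
have sb : 0 < sin b by rewrite sin_gt0_pi.
pose kappa := c (d - 1)%N 1%N / (d%:R * l * sin b); exists kappa.
have two n : 2 * 'C(n, 2)%:R = n%:R * n.-1%:R :> R.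
  by rewrite -!natrM mul_bin_left bin1 subn1 mulnC.
have step k : ((k <= d)%N -> c (d - k)%N k = 'C(d, k)%:R * kappa * l ^+ k * sin (k%:R * b)) /\
   ((k.+1 <= d)%N -> c (d - k.+1)%N k.+1 = 'C(d, k.+1)%:R * kappa * l ^+ k.+1 * sin (k.+1%:R * b)).
  elim: k => [|k [IH0 IH1]].
    split => [_|d0]; first by rewrite subn0 cd0 mul0r sin0 mulr0.
    have dR : (0 : R) < d%:R by rewrite ltr0n.
    rewrite /kappa bin1 expr1 mul1r; field.
    by rewrite !gt_eqF.
  split => // kd; have k1d : (k.+1 <= d)%N by exact: ltnW.
  have k0d : (k <= d)%N by exact: ltnW.
  have := rec k kd; rewrite IH0// IH1//.
  set h2 := c _ _.
  have b1 : (k%:R + 1) * 'C(d, k.+1)%:R = (d - k)%:R * 'C(d, k)%:R :> R.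
    by rewrite natr1 -!natrM mul_bin_left.
  have b2 : (k%:R + 2) * 'C(d, k.+2)%:R = (d - k.+1)%:R * 'C(d, k.+1)%:R :> R.
    by rewrite -natrD addn2 -!natrM mul_bin_left.
  have t1 : 2 * 'C(d - k, 2)%:R = (d - k)%:R * (d - k.+1)%:R :> R.
    by rewrite two subnS.
  have t2 : 2 * 'C(k.+2, 2)%:R = (k%:R + 2) * (k%:R + 1) :> R.
    by rewrite two/= -natrD addn2 natr1.
  have sE : sin (k.+2%:R * b) = 2 * cos b * sin (k.+1%:R * b) - sin (k%:R * b).
    have -> : k.+2%:R * b = k.+1%:R * b + b by rewrite -(natr1 k.+1); ring.
    have -> : k%:R * b = k.+1%:R * b - b by rewrite -(natr1 k); ring.
    by rewrite !sinD sinN cosN; ring.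
  rewrite sE E00 E01 natrM -(natr1 k).
  move: b1 b2 t1 t2.
  have k2 : (k%:R + 2 : R) != 0 by rewrite -natrD pnatr_eq0 addn2.
  have k1 : (k%:R + 1 : R) != 0 by rewrite natr1 pnatr_eq0.
  have MN : M11 != 0 by rewrite gt_eqF.
  rewrite !exprS.
  (* From here on only the relations [b1], [b2], [t1], [t2] between the binomials matter, and the
     claim is a polynomial identity in independent real variables. *)
  move: ('C(d, k)%:R : R) ('C(d, k.+1)%:R : R) ('C(d, k.+2)%:R : R) => c0 c1 c2.
  move: ((d - k)%:R : R) ((d - k.+1)%:R : R) ('C(d - k, 2)%:R : R) ('C(k.+2, 2)%:R : R) => p q t u.
  move: (k%:R : R) k2 k1 (l ^+ k) (sin ((k%:R + 1) * b)) (sin (k%:R * b)) (cos b) (kappa) => K k2 k1 L s1 s0 cb kap.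
  move=> b1 b2 t1 t2 H.
  have H2 : M11 * ((K + 2) * (K + 1)) * h2 =
     M11 * kap * (L * l * l) * (2 * cb * s1 - s0) * (p * q * c0).
    have : 2 * (M11 * u * h2) = - (2 * (M11 * l ^+ 2 * t * (c0 * kap * L * s0)))
         + 2 * (M11 * l * cb * (q * (K + 1)) * (c1 * kap * (l * L) * s1)) by move: H; lra.
    rewrite (_ : 2 * (M11 * u * h2) = M11 * (2 * u) * h2); last by ring.
    rewrite t2 => ->.
    rewrite (_ : 2 * (M11 * l ^+ 2 * t * (c0 * kap * L * s0)) = M11 * l ^+ 2 * (2 * t) * (c0 * kap * L * s0)); last by ring.
    rewrite t1.
    rewrite (_ : 2 * (M11 * l * cb * (q * (K + 1)) * (c1 * kap * (l * L) * s1)) =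
       2 * (M11 * l * cb * q * ((K + 1) * c1) * kap * (l * L) * s1)); last by ring.
    by rewrite b1; ring.
  have H3 : p * q * c0 = (K + 2) * (K + 1) * c2.
    by rewrite mulrAC mulrC -b1 mulrC mulrAC -mulrA [X in _ = X]mulrAC b2; ring.
  have D0 : M11 * ((K + 2) * (K + 1)) != 0 by rewrite !mulf_neq0.
  by apply: (mulfI D0); rewrite H2 H3; ring.
split => [k|x y]; first exact: (step k).1.
rewrite cpow_binomial/= /top_form mulr_sumr; apply: eq_bigr => k _.
rewrite (step k).1; last by rewrite -ltnS.
by rewrite exprMn; ring.
Qed.

(** A small angle gives the sign of [kappa]. If d b > pi, the sine vanishes inside (0, b) at pi / d;
    if d b < pi, it cannot vanish at [b]. *)
Lemma sector_angle d (kappa b : R) : 0 < b < pi ->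
  (forall t, 0 < t < b -> 0 < kappa * sin (d%:R * t)) ->
  kappa * sin (d%:R * b) = 0 -> 0 < kappa /\ d%:R * b = pi.
Proof.
move=> /andP[b0 bpi] pos edge; have pi0 := @pi_gt0 R.
have b2 : 0 < b / 2 < b by apply/andP; split; lra.
have d0 : (0 < d)%N.
  rewrite lt0n; apply/eqP => dd; have := pos _ b2.
  by rewrite dd mul0r sin0 mulr0 ltxx.
have dR : (0 : R) < d%:R by rewrite ltr0n.
have kN : kappa != 0 by apply/eqP => k0; have := pos _ b2; rewrite k0 mul0r ltxx.
have k0 : 0 < kappa.
  pose t := Num.min (b / 2) (pi / 2 / d%:R).
  have t0 : 0 < t by rewrite lt_min !divr_gt0.
  have tb : t < b by rewrite gt_min; apply/orP; left; lra.
  have dt : d%:R * t <= pi / 2 by rewrite mulrC -ler_pdivlMr// ge_min lexx orbT.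
  have := pos t; rewrite t0 tb => /(_ isT); rewrite pmulr_lgt0// sin_gt0_pi//.
  by rewrite mulr_gt0//=; lra.
have spos t : 0 < t < b -> 0 < sin (d%:R * t) by move/pos; rewrite pmulr_rgt0.
split => //; apply/eqP; rewrite eq_le; apply/andP; split; rewrite leNgt; apply/negP => h.
  have := spos (pi / d%:R); rewrite divr_gt0// ltr_pdivrMr// [b * _]mulrC h => /(_ isT).
  by rewrite mulrC divfK ?gt_eqF// sinpi ltxx.
move/eqP: edge; rewrite mulf_eq0 (negbTE kN)/= gt_eqF// sin_gt0_pi// h andbT.
by rewrite mulr_gt0.
Qed.

End TopForm.

(** * Comparison of the lower order terms with the dominant term *)

Section Growth.
Context {R : realType}.
Implicit Types (c : nat -> nat -> R) (d : nat) (x y : R).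

(** The symmetry [t] to [b - t] reduces to [d t <= pi / 2], where the sine increases and sin t <=
    sin (d t). The left side is kept as a product because r ^ 2 times it is proportional to x y. *)
Lemma sin_sector_ge d (b t : R) : (0 < d)%N -> d%:R * b = pi -> 0 < t < b ->
  sin t * sin (b - t) <= sin (d%:R * t).
Proof.
move=> d0 db /andP[t0 tb].
have d1 : (1 : R) <= d%:R by rewrite ler1n.
wlog : t t0 tb / d%:R * t <= pi / 2.
  move=> H; have [h|h] := leP (d%:R * t) (pi / 2); first exact: H.
  have h' : d%:R * (b - t) <= pi / 2 by rewrite mulrBr db; lra.
  have := H (b - t) _ _ h'; rewrite subr_gt0 tb gtrBl t0 => /(_ isT isT).
  rewrite subKr mulrC => /le_trans; apply; rewrite mulrBr db.
  by rewrite addrC sinDpi sinN opprK.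
move=> h.
have ht : t <= d%:R * t by rewrite ler_peMl// ltW.
have p0 := @pi_gt0 R.
have st : 0 <= sin t by apply: sin_ge0_pi; apply/andP; split; lra.
apply: (@le_trans _ _ (sin t)); first by rewrite ler_piMr// sin_le1.
rewrite leNgt ltr_sin ?in_itv//=; first by rewrite -leNgt.
  by apply/andP; split; lra.
by apply/andP; split; lra.
Qed.

(** In polar coordinates x sin b = r sin (b - t) and l y sin b = r sin t, so [sin_sector_ge] bounds
    r ^ 2 sin (d t) below by l sin b ^ 2 x y. The remaining r ^ (d - 2) is handled by
    [x + y <= m * r]. *)
Lemma sector_form_ge d (kappa l b : R) : 0 < kappa -> 0 < l -> 0 < b < pi ->
  d%:R * b = pi ->
  exists2 C0, 0 < C0 & forall x y, 0 < x -> 0 < y ->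
    C0 * (x * y * (x + y) ^+ (d - 2)) <=
    kappa * (cpow d (x + l * y * cos b) (l * y * sin b)).2.
Proof.
move=> k0 l0 /andP[b0 bpi] db.
have sb : 0 < sin b by rewrite sin_gt0_pi// b0.
have d2 : (1 < d)%N.
  rewrite ltnNge; apply/negP; rewrite leq_eqVlt ltnS leqn0 => /orP[] /eqP dd; move: db; rewrite dd.
    by rewrite mul1r => bb; move: bpi; rewrite bb ltxx.
  by rewrite mul0r => pp; have := @pi_gt0 R; rewrite -pp ltxx.
pose m := (sin b)^-1 + (l * sin b)^-1.
have m0 : 0 < m by rewrite addr_gt0// invr_gt0// mulr_gt0.
exists (kappa * l * sin b ^+ 2 / m ^+ (d - 2)).
  by rewrite divr_gt0 ?exprn_gt0// !mulr_gt0// exprn_gt0.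
move=> x y x0 y0.
pose z : 'cV[R]_2 := \col_i (if i == 0 then x else l * y).
have z0 : mrow 1%:M 0 z = x by rewrite /mrow mul1mx mxE.
have z1 : mrow 1%:M 1 z = l * y by rewrite /mrow mul1mx mxE.
have zpos i : 0 < mrow 1%:M i z by case: (ord2P i) => ->; rewrite ?z0 ?z1 ?mulr_gt0.
have u1 : (1%:M : 'M[R]_2) \in unitmx by exact: unitmx1.
have [r [t [r0 /andP[t0 tb] zE _]]] := sector_polar u1 b0 bpi zpos.
have [E0 E1] := mrow_sector_pt b u1 r t; rewrite -zE z0 in E0; rewrite -zE z1 in E1.
have [F0 F1] := mrow_sector u1 b0 bpi r t.
have [G0 G1] := mrow_sector_mx (1%:M : 'M[R]_2) b z.
rewrite z0 z1 zE F0 in G0; rewrite z1 zE F1 in G1.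
rewrite [l * y * cos b]mulrC -G0 [l * y * sin b]mulrC -G1 cpow_polar/=.
have xE : x * sin b = r * sin (b - t) by rewrite E0 divfK// gt_eqF.
have yE : l * y * sin b = r * sin t by rewrite E1 divfK// gt_eqF.
have rm : x + y <= m * r.
  have h1 : x <= (sin b)^-1 * r.
    by rewrite mulrC ler_pdivlMr// xE ler_piMr ?sin_le1// ltW.
  have h2 : y <= (l * sin b)^-1 * r.
    by rewrite mulrC ler_pdivlMr ?mulr_gt0// mulrCA mulrA yE ler_piMr ?sin_le1// ltW.
  by rewrite /m mulrDl; exact: lerD.
have r2 : r ^+ d = r ^+ (d - 2) * r ^+ 2 by rewrite -exprD subnK.
apply: (@le_trans _ _ (kappa * (r ^+ d * (sin t * sin (b - t))))); last first.
  rewrite ler_pM2l// ler_pM2l ?exprn_gt0// sin_sector_ge ?t0//.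
  by rewrite ltnW.
have -> : kappa * (r ^+ d * (sin t * sin (b - t))) = kappa * l * sin b ^+ 2 * (x * y) * r ^+ (d - 2).
  transitivity (kappa * r ^+ (d - 2) * ((r * sin t) * (r * sin (b - t)))); first by rewrite r2; ring.
  by rewrite -xE -yE; ring.
have key : (x + y) ^+ (d - 2) / m ^+ (d - 2) <= r ^+ (d - 2).
  rewrite ler_pdivrMr ?exprn_gt0// -exprMn [r * m]mulrC.
  by rewrite lerXn2r ?nnegrE ?addr_ge0 ?mulr_ge0// ltW.
set A := kappa * l * sin b ^+ 2.
have A0 : 0 < A by rewrite !mulr_gt0// exprn_gt0.
rewrite (_ : A / m ^+ (d - 2) * (x * y * (x + y) ^+ (d - 2)) =
  A * (x * y) * ((x + y) ^+ (d - 2) / m ^+ (d - 2))); last by ring.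
by rewrite ler_pM2l// !mulr_gt0.
Qed.

(** Every monomial of degree below [d] with a nonzero coefficient contains x y, and what remains,
    times x + y, has degree at most d - 2. As x + y >= 1, it can be raised to exactly d - 2. *)
Lemma lower_order_le c d : (1 < d)%N -> (forall i j, (d < i + j)%N -> c i j = 0) ->
  (forall i, c i 0%N = 0) -> (forall j, c 0%N j = 0) ->
  exists2 C1, 0 <= C1 & forall x y, 1 <= x -> 1 <= y ->
    (x + y) * `|bipoly c d x y - top_form c d x y| <= C1 * (x * y * (x + y) ^+ (d - 2)).
Proof.
move=> d2 cd ci cj; exists (\sum_(i < d.+1) \sum_(j < d.+1) `|c i j|).
  by apply: sumr_ge0 => i _; apply: sumr_ge0.
move=> x y x1 y1.
have x0 : 0 <= x by lra.
have y0 : 0 <= y by lra.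
rewrite /top_form -(sum_antidiagonal d (fun i j => c i j * x ^+ i * y ^+ j)).
rewrite /bipoly -sumrB mulr_suml.
rewrite -{1}(ger0_norm (addr_ge0 x0 y0)) -normrM mulr_sumr.
apply: (le_trans (ler_norm_sum _ _ _)); apply: ler_sum => i _.
rewrite -sumrB mulr_suml mulr_sumr.
apply: (le_trans (ler_norm_sum _ _ _)); apply: ler_sum => j _.
have B0 : 0 <= x * y * (x + y) ^+ (d - 2).
  by rewrite !mulr_ge0// exprn_ge0// addr_ge0.
case: eqVneq => [_|ijd]; first by rewrite subrr mulr0 normr0 mulr_ge0.
rewrite subr0; case: (ltngtP d (i + j)) ijd => // [dij|ijd] _.
  by rewrite cd// !mul0r mulr0 normr0 mul0r.
case: (posnP i) => [->|i0]; first by rewrite cj !mul0r mulr0 normr0 mul0r.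
case: (posnP j) => [->|j0]; first by rewrite ci !mul0r mulr0 normr0 mul0r.
have -> : (x + y) * (c i j * x ^+ i * y ^+ j) = c i j * (x ^+ i * y ^+ j * (x + y)) by ring.
rewrite normrM ler_wpM2l// ger0_norm ?mulr_ge0 ?exprn_ge0 ?addr_ge0//.
rewrite -(prednK i0) -(prednK j0) !exprS.
rewrite (_ : x * x ^+ i.-1 * (y * y ^+ j.-1) * (x + y) = x * y * (x ^+ i.-1 * y ^+ j.-1 * (x + y))); last by ring.
rewrite ler_wpM2l ?mulr_ge0//.
have xy1 : 1 <= x + y by lra.
apply: (@le_trans _ _ ((x + y) ^+ i.-1 * (x + y) ^+ j.-1 * (x + y))).
  rewrite ler_wpM2r ?addr_ge0// ler_pM ?exprn_ge0// lerXn2r ?nnegrE ?addr_ge0//; lra.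
rewrite -exprD -exprSr; apply: ler_weXn2l => //.
by move: i0 j0 ijd d2; lia.
Qed.

End Growth.

(** * The killed walk *)

Section KilledWalk.
Context {R : realType}.
Variables (S : {fset 'cV[int]_2}) (a : 'cV[int]_2 -> R).
Implicit Types (g h : 'cV[int]_2 -> R) (x y s : 'cV[int]_2) (m n : nat) (K : R).

Definition in_quadrant y : bool := (0 < y 0 0) && (0 < y 1 0).

(** Transition operator of the killed walk. Its iterates are the killed expectations
    ([killed_expectationE]), so the limit can be studied with finite sums and no probability
    space. *)
Definition killed_step g y : R :=
  \sum_(s <- S) a s * (if in_quadrant (y + s) then g (y + s) else 0).

Definition killed n g : 'cV[int]_2 -> R := iter n killed_step g.

Hypothesis a_ge0 : forall s, s \in S -> 0 <= a s.
Hypothesis a_sum1 : \sum_(s <- S) a s = 1.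

Lemma killed_stepD g h (b : R) y :
  killed_step (fun y => g y + b * h y) y = killed_step g y + b * killed_step h y.
Proof.
rewrite /killed_step mulr_sumr -big_split/=; apply: eq_bigr => s _.
by case: ifP => _; ring.
Qed.

Lemma killedD n g h (b : R) y :
  killed n (fun y => g y + b * h y) y = killed n g y + b * killed n h y.
Proof.
elim: n y => [//|n IH] y; rewrite /killed !iterS -killed_stepD.
by congr (killed_step _ y); apply/funext => z; exact: IH.
Qed.

Lemma killedZ n g (b : R) y : killed n (fun y => b * g y) y = b * killed n g y.
Proof.
have := killedD n (fun=> 0) g b y.
under eq_fun do rewrite add0r; move=> ->.
have -> : killed n (fun=> 0) y = 0; last by rewrite add0r.
elim: n y => [//|n IH] y; rewrite /killed iterS /killed_step big1// => s _.
by case: ifP => _; rewrite ?mulr0//; move: (IH (y + s)); rewrite /killed => ->; rewrite mulr0.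
Qed.

Lemma le_killed_step g h : (forall y, in_quadrant y -> g y <= h y) ->
  forall y, killed_step g y <= killed_step h y.
Proof.
move=> gh y; rewrite /killed_step big_seq [leRHS]big_seq.
apply: ler_sum => s sS; apply: ler_wpM2l; first exact: a_ge0.
by case: ifP => // ys; exact: gh.
Qed.

Lemma le_killed n g h : (forall y, in_quadrant y -> g y <= h y) ->
  forall y, in_quadrant y -> killed n g y <= killed n h y.
Proof.
move=> gh; elim: n => [//|n IH] y _; rewrite /killed !iterS.
by apply: le_killed_step; exact: IH.
Qed.

Lemma eq_killed n g h : (forall y, in_quadrant y -> g y = h y) ->
  forall y, in_quadrant y -> killed n g y = killed n h y.
Proof.
move=> gh y yq; apply/eqP; rewrite eq_le; apply/andP.
by split; apply: le_killed => // z zq; rewrite gh.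
Qed.

Lemma killed_ge0 n g y : (forall y, in_quadrant y -> 0 <= g y) -> in_quadrant y ->
  0 <= killed n g y.
Proof.
move=> g0 yq; have := killedZ n g 0 y; rewrite mul0r => <-.
by apply: le_killed => // z zq; rewrite mul0r g0.
Qed.

Lemma killed_norm n g y : in_quadrant y -> `|killed n g y| <= killed n (fun y => `|g y|) y.
Proof.
move=> yq; rewrite ler_norml; apply/andP; split.
  rewrite -mulN1r -killedZ; apply: le_killed => // z _.
  by rewrite mulN1r lerNnormlW.
by apply: le_killed => // z _; exact: ler_norm.
Qed.

Lemma killed_le1 n y : in_quadrant y -> killed n (fun=> 1) y <= 1.
Proof.
elim: n y => [//|n IH] y yq; rewrite /killed iterS.
rewrite -[leRHS]a_sum1 /killed_step big_seq [leRHS]big_seq; apply: ler_sum => s sS.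
rewrite -[leRHS]mulr1; apply: ler_wpM2l; first exact: a_ge0.
by case: ifP => // ys; exact: IH.
Qed.

(* A left step, repeated [m] times, leaves the quadrant from abscissa [<= m]. *)
Lemma killed_exit sl m y : sl \in S -> sl 0 0 = -1 -> in_quadrant y ->
  y 0 0 <= m%:Z -> killed m (fun=> 1) y <= 1 - a sl ^+ m.
Proof.
move=> slS sl1; elim: m y => [|m IH] y yq ym.
  by case/andP: yq => /lt_le_trans/(_ ym); rewrite ltxx.
have al0 : 0 <= a sl by exact: a_ge0.
have al1 : a sl <= 1.
  rewrite -a_sum1 (big_fsetD1 sl)//= lerDl big_seq sumr_ge0// => s.
  by rewrite in_fsetD1 => /andP[_ sS]; exact: a_ge0.
rewrite /killed iterS /killed_step (big_fsetD1 sl)//=.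
have -> : 1 - a sl ^+ m.+1 = a sl * (1 - a sl ^+ m) + (1 - a sl) by rewrite exprS; ring.
apply: lerD.
  apply: ler_wpM2l => //; case: ifP => ys; last first.
    by rewrite subr_ge0 exprn_ile1.
  by apply: IH => //; rewrite mxE sl1 lerBlDr (le_trans ym)// -addn1 PoszD.
have -> : 1 - a sl = \sum_(s <- (S `\ sl)%fset) a s by rewrite -a_sum1 (big_fsetD1 sl)//= [LHS]addrC addKr.
rewrite big_seq [leRHS]big_seq; apply: ler_sum => s.
rewrite in_fsetD1 => /andP[_ sS]; rewrite -[leRHS]mulr1; apply: ler_wpM2l; first exact: a_ge0.
by case: ifP => // ys; exact: (@killed_le1 m).
Qed.

Lemma killed_escape sl K x : sl \in S -> sl 0 0 = -1 -> 0 < a sl -> in_quadrant x ->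
  (fun n => killed n (fun y => ((y 0 0)%:~R <= K)%R%:R) x) @ \oo --> (0 : R).
Proof.
move=> slS sl1 al0 xq.
pose m := (Num.truncn K).+1.
have Km y : (y 0 0)%:~R <= K -> y 0 0 <= m%:Z.
  move=> yK; rewrite -(ler_int R); apply: (le_trans yK); apply/ltW.
  exact: truncnS_gt.
pose q n := killed n (fun=> 1 : R) x.
have qS n : q n.+1 <= q n.
  rewrite /q /killed iterSr; apply: le_killed => // y yq.
  exact: (@killed_le1 1).
have cq : cvgn q.
  apply: nonincreasing_is_cvgn; first by apply/nonincreasing_seqP.
  by exists 0 => _ [n _ <-]; apply: killed_ge0.
(* The mass at abscissa at most [K] at time [n] loses at least the fraction [a sl ^+ m] during the
   next [m] steps, so it is bounded by this quotient. *)
have c0 : (fun n => (q n - q (n + m)%N) / a sl ^+ m) @ \oo --> (0 : R).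
  rewrite -(mul0r ((a sl ^+ m)^-1)); apply: cvgM; last exact: cvg_cst.
  rewrite -(subrr (limn q)); apply: cvgB; first exact: cq.
  by have := cq; rewrite -(cvg_shiftn m q).
apply: (squeeze_cvgr _ (cvg_cst 0) c0).
apply: nearW => n; apply/andP; split; first by apply: killed_ge0 => // y _; case: (_ <= _).
rewrite ler_pdivlMr ?exprn_gt0// mulrC.
have -> : q (n + m)%N = killed n (killed m (fun=> 1)) x by rewrite /q /killed iterD.
have /(le_trans) : killed n (killed m (fun=> 1)) x <=
    killed n (fun y => 1 + - a sl ^+ m * ((y 0 0)%:~R <= K)%R%:R) x.
  apply: le_killed => // y yq; case: (boolP ((y 0 0)%:~R <= K)) => [yK|_].
    by rewrite mulr1; apply: killed_exit => //; exact: Km.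
  by rewrite mulr0 addr0; exact: killed_le1.
by move=> /(_ _ (lexx _)); rewrite killedD -/(q n); lra.
Qed.

(* Far away [g - h] is negligible compared to [h], and by [killed_escape] bounded
   sets do not contribute in the limit. *)
Lemma killed_cvg sl x g h (C : R) : sl \in S -> sl 0 0 = -1 -> 0 < a sl ->
  in_quadrant x ->
  (forall y, in_quadrant y -> killed_step g y = g y) ->
  (forall y, in_quadrant y -> 0 <= h y) ->
  (forall y, in_quadrant y -> (y 0 0 + y 1 0)%:~R * `|g y - h y| <= C * h y) -> 0 <= C ->
  (forall K, exists M, forall y, in_quadrant y -> (y 0 0 + y 1 0)%:~R <= K -> h y <= M) ->
  (fun n => killed n h x) @ \oo --> g x.
Proof.
move=> slS sl1 al0 xq gharm h0 gh C0 hM.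
pose N y : R := (y 0 0 + y 1 0)%:~R.
have N1 y : in_quadrant y -> 1 <= N y.
  move=> /andP[y0 y1]; rewrite /N -[1]/(1%:~R) ler_int.
  by rewrite -[leLHS]addr0; apply: lerD; [rewrite -gtz0_ge1|exact: ltW].
have yN y : in_quadrant y -> (y 0 0)%:~R <= N y :> R.
  by move=> /andP[y0 y1]; rewrite /N ler_int lerDl ltW.
have gT n : killed n g x = g x.
  have H y : in_quadrant y -> killed n g y = g y.
    elim: n y => [//|n IH] y yq; rewrite /killed iterSr -[RHS](IH y yq).
    by apply: eq_killed => // z zq; exact: gharm.
  exact: H.
pose b (K : R) n := killed n (fun y => ((y 0 0)%:~R <= K)%R%:R) x.
have b_cvg K : b K @ \oo --> (0 : R) by exact: killed_escape slS sl1 al0 xq.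
(* Beyond [K0] one has |g - h| <= h / 2, hence h <= 2 g; below it [h] is bounded. Since [g] is
   preserved, this yields the uniform bound [E]. *)
pose K0 := Num.max 1 (2 * C).
have K00 : 0 < K0 by rewrite lt_max ltr01.
have [M0 hM0] := hM K0.
have M1 : 0 <= Num.max 0 M0 by rewrite le_max lexx.
have h_le y : in_quadrant y -> h y <= 2 * g y + 2 * C * Num.max 0 M0.
  move=> yq; have N1y := N1 y yq; have hy := h0 y yq; have := gh y yq; rewrite -/(N y) => ghy.
  have [yK|Ky] := leP (N y) K0.
    have hMy : h y <= Num.max 0 M0 by rewrite le_max hM0 ?orbT.
    have : `|g y - h y| <= C * h y.
      by apply: le_trans ghy; rewrite ler_peMl.
    have : C * h y <= C * Num.max 0 M0 by rewrite ler_wpM2l.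
    by rewrite ler_norml => ? /andP[? ?]; lra.
  have : `|g y - h y| <= h y / 2.
    have NC : 2 * C <= N y by rewrite (le_trans _ (ltW Ky))// le_max lexx orbT.
    have N0 : 0 < N y by lra.
    rewrite -(ler_pM2l N0); apply: (le_trans ghy).
    by have := ler_wpM2r hy NC; lra.
  have := mulr_ge0 C0 M1.
  by rewrite ler_norml => ? /andP[? ?]; lra.
pose E := 2 * g x + 2 * C * Num.max 0 M0.
have hE n : killed n h x <= E.
  apply: (@le_trans _ _ (killed n (fun y => 2 * C * Num.max 0 M0 + 2 * g y) x)).
    by apply: le_killed => // y yq; rewrite addrC h_le.
  rewrite killedD gT /E addrC lerD2l.
  have := killedZ n (fun=> 1) (2 * C * Num.max 0 M0) x.
  under eq_fun do rewrite mulr1; move=> ->.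
  by rewrite ler_piMr ?killed_le1// !mulr_ge0.
have E0 : 0 <= E by apply: le_trans (hE 0%N); apply: h0.
(* Points beyond level [K] contribute at most C / K times the expectation of [h], the others a
   constant times the mass [b K n]. So [K] is chosen first, then [n]. *)
have diff_le K n : 0 < K -> exists2 M, 0 <= M &
   forall n, `|g x - killed n h x| <= C * E / K + C * M * b K n.
  move=> K_; have [M hMK] := hM K; exists (Num.max 0 M); first by rewrite le_max lexx.
  move=> {}n; rewrite -(gT n) -mulN1r -killedD.
  apply: (le_trans (killed_norm _ _ xq)).
  apply: (@le_trans _ _ (killed n (fun y => C / K * h y + C * Num.max 0 M * ((y 0 0)%:~R <= K)%R%:R) x)).
    apply: le_killed => // y yq; rewrite mulN1r.
    have N1y := N1 y yq; have hy := h0 y yq; have := gh y yq; rewrite -/(N y) => ghy.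
    have [yK|Ky] := leP (N y) K.
      rewrite (le_trans (yN y yq) yK) mulr1.
      have h1 : `|g y - h y| <= C * h y by apply: le_trans ghy; rewrite ler_peMl.
      have h2 : C * h y <= C * Num.max 0 M by rewrite ler_wpM2l// le_max hMK ?orbT.
      have h3 : 0 <= C / K * h y by rewrite mulr_ge0// divr_ge0// ltW.
      by lra.
    have h1 : `|g y - h y| <= C / K * h y.
      rewrite mulrAC ler_pdivlMr//; apply: le_trans ghy; rewrite mulrC.
      by rewrite ler_wpM2r// ltW.
    have h2 : 0 <= C * Num.max 0 M * ((y 0 0)%:~R <= K)%R%:R.
      by rewrite !mulr_ge0// le_max lexx.
    by lra.
  rewrite killedD killedZ -/(b K n) lerD2r mulrAC ler_wpM2r ?invr_ge0 ?(ltW K_)//.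
  by rewrite ler_wpM2l.
apply/cvgrPdist_le => e e0.
pose K := 2 * (C * E + 1) / e.
have CE : 0 <= C * E by rewrite mulr_ge0.
have K_ : 0 < K by rewrite divr_gt0// mulr_gt0//; lra.
have [M M_ dM] := diff_le K 0%N K_.
have CEK : C * E / K <= e / 2.
  rewrite ler_pdivrMr// /K; have -> : e / 2 * (2 * (C * E + 1) / e) = C * E + 1.
    by field; rewrite gt_eqF.
  by lra.
have e2 : 0 < e / (2 * (C * M + 1)).
  by rewrite divr_gt0// mulr_gt0// ltr_pwDr// mulr_ge0.
near=> n.
apply: (le_trans (dM n)).
have bn : b K n <= e / (2 * (C * M + 1)).
  by near: n; exact: (cvgr_le _ (b_cvg K) _ e2).
have CM : 0 <= C * M by rewrite mulr_ge0.
have : C * M * b K n <= e / 2; last by lra.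
apply: (@le_trans _ _ (C * M * (e / (2 * (C * M + 1))))); first by rewrite ler_wpM2l.
rewrite mulrA ler_pdivrMr; last by lra.
by nra.
Unshelve. all: by end_near. Qed.

End KilledWalk.

(** * The law of the walk *)

Section Words.
Context {R : realType}.
Variables (S : {fset 'cV[int]_2}) (a : 'cV[int]_2 -> R).
Implicit Types (v : seq 'cV[int]_2) (x s : 'cV[int]_2).

Fixpoint words n : seq (seq 'cV[int]_2) :=
  if n is m.+1 then [seq s :: v | s <- S, v <- words m] else [:: [::]].

Lemma mem_words n v : (v \in words n) = (size v == n) && all (mem S) v.
Proof.
elim: n v => [|n IH] [|s v] //=.
- by apply/negbTE/allpairsP => -[[? ?] []].
- apply/allpairsP/idP => [[[s' v'] /= [sS vn [-> ->]]]|].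
    by move: vn; rewrite IH eqSS sS.
  by rewrite eqSS => /and3P[sn sS vS]; exists (s, v); split => //=; rewrite IH sn.
Qed.

Lemma uniq_words n : uniq (words n).
Proof.
elim: n => //= n IH; apply: allpairs_uniq => //; first exact: fset_uniq.
by move=> [s v] [s' v'] _ _ [-> ->].
Qed.

(** The starting point is not tested, in accordance with an exit time whose infimum starts at time
    1. *)
Fixpoint stays x v : bool :=
  if v is s :: v' then in_quadrant (x + s) && stays (x + s) v' else true.

Lemma staysP x v : reflect (forall m, (1 <= m <= size v)%N ->
  in_quadrant (x + \sum_(s <- take m v) s)) (stays x v).
Proof.
elim: v x => [|s v IH] x /=.
  by apply: ReflectT => m; rewrite leqn0 => /andP[m0 /eqP m1]; rewrite m1 in m0.
apply: (iffP andP) => [[xs /IH H] [|[|m]] // /andP[_ mv]|H].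
- by rewrite /= take0 big_seq1.
- by rewrite /= big_cons addrA; apply: H.
- split; first by have := H 1%N isT; rewrite /= take0 big_seq1.
  apply/IH => m /andP[m1 mv]; have := H m.+1; rewrite ltnS /= big_cons addrA; exact.
Qed.

Lemma killed_words (g : 'cV[int]_2 -> R) n x :
  killed S a n g x = \sum_(v <- words n) (\prod_(s <- v) a s) *
     (if stays x v then g (x + \sum_(s <- v) s) else 0).
Proof.
elim: n x => [|n IH] x; first by rewrite big_seq1 !big_nil mul1r addr0.
rewrite /killed iterS /killed_step /= big_allpairs_dep/=.
apply: eq_bigr => s _.
under eq_bigr do rewrite !big_cons -mulrA.
rewrite -mulr_sumr; congr (_ * _); case: ifP => xs; last first.
  by rewrite big1// => v _; rewrite mulr0.
rewrite [iter _ _ _ _]IH; apply: eq_bigr => v _ /=.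
by rewrite addrA.
Qed.

End Words.

(** * The law of the first steps *)

Section WalkLaw.
Context {R : realType} {d : measure_display} {T : measurableType d}.
Variables (Pr : probability T R) (X : nat -> T -> 'cV[int]_2).
Variables (S : {fset 'cV[int]_2}) (a : 'cV[int]_2 -> R).
Hypothesis a_sum1 : \sum_(s <- S) a s = 1.
Hypothesis X_iid : iid_steps Pr X S a.

Definition steps n (w : T) : seq 'cV[int]_2 := [seq X k w | k <- iota 0 n].

Lemma size_steps n w : size (steps n w) = n.
Proof. by rewrite size_map size_iota. Qed.

Lemma walk_steps n m w : (m <= n)%N -> walk X m w = \sum_(s <- take m (steps n w)) s.
Proof.
move=> mn; rewrite /steps -map_take take_iota (minn_idPl mn) big_map.
by rewrite -[in iota _ _](subn0 m) -/(index_iota 0 m) big_mkord.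
Qed.

Lemma in_quadrantP (y : 'cV[int]_2) : in_quadrant y <-> open_quadrant (toR y : 'cV[R]_2).
Proof.
rewrite /in_quadrant /open_quadrant; split.
  by move=> /andP[y0 y1] i; rewrite mxE ltr0z; case: (ord2P i) => ->.
by move=> h; have := h 0; have := h 1; rewrite !mxE !ltr0z => -> ->.
Qed.

Lemma exit_time_steps x n w : (n%:R%:E < exit_time (R := R) X x w)%E <-> stays x (steps n w).
Proof.
split => [h|/staysP h].
  apply/staysP => m; rewrite size_steps => /andP[m1 mn]; rewrite -walk_steps//.
  apply: contraPT h => /negP xm; apply/negP; rewrite -leNgt.
  apply: ge_ereal_inf; exists m%:R%:E; last by rewrite lee_fin ler_nat.
  by exists m => //; split => // /in_quadrantP.
(* The strict inequality survives the infimum because exit times are integers: all are at least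
   [n.+1]. No exit at all gives the infimum of the empty set. *)
apply: (@lt_le_trans _ _ n.+1%:R%:E); first by rewrite lte_fin ltr_nat.
apply: le_ereal_inf_tmp => _ [m [m1 xm] <-]; rewrite lee_fin ler_nat ltnNge.
apply/negP => mn; apply: xm; apply/in_quadrantP.
by rewrite (walk_steps w mn); apply: h; rewrite m1 size_steps.
Qed.

Let mX k (A : set 'cV[int]_2) : measurable (X k @^-1` A). Proof. by case: X_iid. Qed.

Lemma steps_eqE n v : size v = n ->
  steps n @^-1` [set v] = \bigcap_(k in [set` [fset k in iota 0 n]%fset]) (X k @^-1` [set nth 0 v k]).
Proof.
move=> vn; apply/seteqP; split => w /=.
  move=> <- k /=; rewrite inE/= mem_iota/= add0n => kn.
  by rewrite (nth_map 0%N) ?size_iota// nth_iota.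
move=> h; apply: (@eq_from_nth _ 0); first by rewrite size_steps.
move=> k; rewrite size_steps => kn; rewrite (nth_map 0%N) ?size_iota// nth_iota//.
by apply: h; rewrite /= inE/= mem_iota.
Qed.

Lemma measurable_steps_eq n v : measurable (steps n @^-1` [set v]).
Proof.
have [vn|vn] := eqVneq (size v) n.
  rewrite (steps_eqE vn); apply: fin_bigcap_measurable => // k _; exact: mX.
rewrite (_ : _ @^-1` _ = set0)//; apply/seteqP; split => // w /= wv.
by move: vn; rewrite -wv size_steps eqxx.
Qed.

(** Words form a countable type, so any event depending on the first [n] steps is a countable union
    of events with a fixed word. *)
Lemma measurable_steps n (V : set (seq 'cV[int]_2)) : measurable (steps n @^-1` V).
Proof.
rewrite (_ : steps n @^-1` V = \bigcup_v (if v \in V then steps n @^-1` [set v] else set0)).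
  apply: countable_bigcupT_measurable => [|v]; first exact: countableP.
  by case: ifP => _ //; exact: measurable_steps_eq.
apply/seteqP; split => w /=.
  by move=> Vw; exists (steps n w) => //; rewrite mem_set.
by move=> [v _]; case: ifPn => // /set_mem Vv /= ->.
Qed.

Lemma steps_law n v : v \in words S n ->
  Pr (steps n @^-1` [set v]) = (\prod_(s <- v) a s)%:E.
Proof.
rewrite mem_words => /andP[/eqP vn /allP vS].
have [_ XS indep] := X_iid.
rewrite (steps_eqE vn) (indep _ (fun k => [set nth 0 v k])).
have pi_ : perm_eq [fset k in iota 0 n]%fset (iota 0 n).
  apply: uniq_perm; [exact: fset_uniq|exact: iota_uniq|].
  by move=> k; rewrite inE.
rewrite (perm_big _ pi_)/=.
rewrite [in RHS](big_nth 0) vn /index_iota subn0.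
rewrite -prodEFin; rewrite big_seq [RHS]big_seq; apply: eq_bigr => k.
rewrite mem_iota add0n => /andP[_ kn]; apply: XS; apply: vS.
by apply: mem_nth; rewrite vn.
Qed.

(** The law is prescribed only at the points of [S]; as the weights sum to 1, no mass is left
    outside. *)
Lemma steps_ae n : \forall w \ae Pr, steps n w \in words S n.
Proof.
have XS k : \forall w \ae Pr, X k w \in S.
  have [_ XSa _] := X_iid.
  have P1 : Pr (X k @^-1` [set` S]) = 1%E.
    rewrite (_ : X k @^-1` [set` S] = \bigcup_(s in [set` S]) (X k @^-1` [set s])).
      rewrite measure_fin_bigcup//; last by move=> s s' _ _ [w [/= <- <-]].
      rewrite -fsbig_seq ?fset_uniq//=.
      rewrite big_seq (eq_bigr (fun s => (a s)%:E)); last by move=> s sS; rewrite XSa.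
      by rewrite -big_seq sumEFin a_sum1.
    apply/seteqP; split => w /=; first by move=> wS; exists (X k w).
    by move=> [s sS /= ->].
  exists (X k @^-1` (~` [set` S])); split => //.
    rewrite (_ : X k @^-1` (~` _) = ~` (X k @^-1` [set` S]))//.
    by rewrite probability_setC// P1 subee.
have : \forall w \ae Pr, forall k, X k w \in S by exact: ae_foralln.
apply: filterS => w h; rewrite mem_words size_steps eqxx/=.
by apply/allP => s /mapP[k _ ->]; exact: h.
Qed.

(** Almost surely the first [n] steps form a word over [S], so the integrand is a finite combination
    of indicators of words. Its integral is the path expansion [killed_words]. *)
Lemma killed_expectationE (u0 : 'cV[R]_2 -> R) x n :
  killed_expectation Pr X u0 x n = (killed S a n (fun y => u0 (toR y)) x)%:E.
Proof.
pose F v := if stays x v then u0 (toR (x + \sum_(s <- v) s)) else 0 : R.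
pose A v := steps n @^-1` [set v].
have mA v : measurable (A v) by exact: measurable_steps_eq.
rewrite /killed_expectation integral_mkcond.
transitivity (\int[Pr]_w (F (steps n w))%:E)%E.
  apply: eq_integral => w _; rewrite patchE /F.
  case: ifPn => [/set_mem/= /exit_time_steps -> |].
    by rewrite (@walk_steps n)// take_oversize ?size_steps.
  by rewrite notin_setE/= => h; case: ifP => // /exit_time_steps.
have mF : measurable_fun [set: T] (EFin \o (F \o steps n)).
  move=> _ Y mY; rewrite setTI.
  exact: (@measurable_steps n ((EFin \o F) @^-1` Y)).
have iA v : Pr.-integrable setT (fun w => ((F v)%:E * (\1_(A v) w)%:E)%E).
  by apply: integrableZl => //; exact: integrable_indic.
transitivity (\int[Pr]_w (\sum_(v <- words S n) ((F v)%:E * (\1_(A v) w)%:E)))%E.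
  apply: ae_eq_integral => //.
    by apply: measurable_int; exact: integrable_sum.
  apply: filterS (steps_ae n) => w wS _.
  rewrite (bigD1_seq (steps n w))//= ?uniq_words//.
  rewrite indicE mem_set// mule1 big1 ?adde0// => v vw.
  by rewrite indicE memNset ?mule0// => /esym/eqP; rewrite (negbTE vw).
rewrite integral_sum// killed_words -sumEFin.
rewrite big_seq [RHS]big_seq; apply: eq_bigr => v vS.
rewrite integralZl//; last exact: integrable_indic.
rewrite integral_indic// setIT [X in (_ * X)%E](_ : _ = (\prod_(s <- v) a s)%:E); last exact: steps_law.
by rewrite -EFinM mulrC.
Qed.

End WalkLaw.

(** * The square root of the covariance matrix *)

Section SquareRoot.
Context {R : realType}.
Implicit Types (M Q : 'M[R]_2) (v : 'cV[R]_2).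

Lemma dotE v w : dot v w = v 0 0 * w 0 0 + v 1 0 * w 1 0.
Proof.
rewrite /dot mxE big_ord_recl big_ord1 !mxE.
by congr (v _ _ * w _ _ + v _ _ * w _ _); apply/val_inj.
Qed.

Lemma quadratic_formE M v : dot v (M *m v) =
  M 0 0 * v 0 0 ^+ 2 + (M 0 1 + M 1 0) * v 0 0 * v 1 0 + M 1 1 * v 1 0 ^+ 2.
Proof.
by rewrite dotE -!/(mrow M _ _) !mrowE; ring.
Qed.

Lemma posdef_entries M : posdef M ->
  [/\ M 1 0 = M 0 1, 0 < M 0 0, 0 < M 1 1 & 0 < M 0 0 * M 1 1 - M 0 1 ^+ 2].
Proof.
move=> [Msym Mpos].
have M10 : M 1 0 = M 0 1 by rewrite -{1}Msym mxE.
have pos (x y : R) : (x != 0) || (y != 0) ->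
    0 < M 0 0 * x ^+ 2 + (M 0 1 + M 1 0) * x * y + M 1 1 * y ^+ 2.
  move=> xy; pose v : 'cV[R]_2 := \col_i (if i == 0 then x else y).
  have v0 : v 0 0 = x by rewrite mxE.
  have v1 : v 1 0 = y by rewrite mxE.
  rewrite -v0 -v1 -quadratic_formE; apply: Mpos.
  apply: contraTneq xy => ve; move: v0 v1; rewrite ve !mxE => <- <-.
  by rewrite eqxx.
have M00 : 0 < M 0 0.
  by have := pos 1 0; rewrite oner_eq0 => /(_ isT); rewrite !mulr0 expr1n expr0n/= !mulr0 !addr0 mulr1.
have M11 : 0 < M 1 1.
  by have := pos 0 1; rewrite eqxx oner_eq0 => /(_ isT); rewrite !(mulr0, mul0r) expr1n expr0n/= !(mulr0,add0r) mulr1.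
split => //.
have := pos (- M 0 1) (M 0 0); rewrite (gt_eqF M00) orbT => /(_ isT); rewrite M10.
rewrite (_ : _ + _ = M 0 0 * (M 0 0 * M 1 1 - M 0 1 ^+ 2)); last by ring.
by rewrite pmulr_rgt0.
Qed.

Lemma matrix2P M Q : M 0 0 = Q 0 0 -> M 0 1 = Q 0 1 -> M 1 0 = Q 1 0 -> M 1 1 = Q 1 1 -> M = Q.
Proof.
move=> h00 h01 h10 h11; apply/matrixP => i j.
by case: (ord2P i) => ->; case: (ord2P j) => ->.
Qed.

Lemma mulmx2E M Q i j : (M *m Q) i j = M i 0 * Q 0 j + M i 1 * Q 1 j.
Proof.
rewrite mxE big_ord_recl big_ord1.
by congr (M _ _ * Q _ _ + M _ _ * Q _ _); apply/val_inj.
Qed.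

Lemma unitmx2 M : M 0 0 * M 1 1 - M 0 1 * M 1 0 != 0 -> M \in unitmx.
Proof.
set e := _ - _ => e0.
pose N : 'M[R]_2 := \matrix_(i, j) ((if i == 0 then (if j == 0 then M 1 1 else - M 0 1)
   else (if j == 0 then - M 1 0 else M 0 0)) / e).
have MN : M *m N = 1%:M.
  by apply: matrix2P; rewrite mulmx2E !mxE/= /e; field.
by case: (mulmx1_unit MN).
Qed.

(* By Cayley-Hamilton, [(M + sqrt (det M)) ^ 2 = (tr M + 2 sqrt (det M)) M]. *)
Lemma sqrtmxP M : posdef M -> posdef (sqrtmx M) /\ sqrtmx M *m sqrtmx M = M.
Proof.
move=> pM; have [M10 M00 M11 detM] := posdef_entries pM.
have [Msym Mpos] := pM.
suff : exists Q, posdef Q /\ Q *m Q = M.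
  by move=> H; exact: (@xgetPex _ 0 [set Q | posdef Q /\ Q *m Q = M]).
pose e := Num.sqrt (M 0 0 * M 1 1 - M 0 1 ^+ 2).
have e0 : 0 < e by rewrite sqrtr_gt0.
have e2 : e ^+ 2 = M 0 0 * M 1 1 - M 0 1 ^+ 2 by rewrite sqr_sqrtr// ltW.
pose t := Num.sqrt (M 0 0 + M 1 1 + 2 * e).
have t2' : 0 < M 0 0 + M 1 1 + 2 * e by lra.
have t0 : 0 < t by rewrite sqrtr_gt0.
have t2 : t ^+ 2 = M 0 0 + M 1 1 + 2 * e by rewrite sqr_sqrtr// ltW.
have tN : t != 0 by rewrite gt_eqF.
pose Q := t^-1 *: (M + e%:M).
have QE i j : Q i j = t^-1 * (M i j + e *+ (i == j)) by rewrite !mxE.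
exists Q; split.
  split; first by rewrite /Q linearZ/= linearD/= Msym tr_scalar_mx.
  move=> v vN; rewrite quadratic_formE !QE/= !mulr1n !mulr0n !addr0.
  have := Mpos v vN; rewrite quadratic_formE => h.
  rewrite (_ : _ + _ = t^-1 * ((M 0 0 * v 0 0 ^+ 2 + (M 0 1 + M 1 0) * v 0 0 * v 1 0 + M 1 1 * v 1 0 ^+ 2)
      + e * (v 0 0 ^+ 2 + v 1 0 ^+ 2))); last by ring.
  apply: mulr_gt0; first by rewrite invr_gt0.
  apply: ltr_pwDl => //; apply: mulr_ge0; first exact: ltW.
  by rewrite addr_ge0// sqr_ge0.
have E (x y z w m : R) : x * y + z * w = m * t ^+ 2 ->
    t^-1 * x * (t^-1 * y) + t^-1 * z * (t^-1 * w) = m.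
  move=> H; apply: (mulIf (expf_neq0 2 tN)); rewrite -H; field.
  exact: tN.
by apply: matrix2P; rewrite mulmx2E !QE/= ?mulr1n ?mulr0n ?addr0 ?M10; apply: E; rewrite t2; nra.
Qed.

End SquareRoot.

(** * Conclusion *)

Lemma quadrant_boundary (R : realType) (y : 'cV[R]_2) i :
  quadrant y -> y i 0 = 0 -> boundary quadrant y.
Proof.
move=> yq yi.
have E : [set invmx 1%:M *m y | y in quadrant] = quadrant :> set 'cV[R]_2.
  by apply/seteqP; split => [_ [z zq <-]|z zq]; [|exists z => //]; rewrite invmx1 mul1mx.
have u1 : (1%:M : 'M[R]_2) \in unitmx by exact: unitmx1.
have := @cone_boundary _ 1%:M u1 y i; rewrite E; apply => //.
by rewrite /mrow mul1mx.
Qed.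

Lemma toRD (R : realType) (x y : 'cV[int]_2) : toR (x + y) = toR x + toR y :> 'cV[R]_2.
Proof. by apply/matrixP => i j; rewrite !mxE intrD. Qed.

Lemma top_form_bounded (R : realType) (c : nat -> nat -> R) d (K : R) :
  exists M, forall x y, 0 <= x -> 0 <= y -> x + y <= K -> top_form c d x y <= M.
Proof.
exists (\sum_(k < d.+1) `|c (d - k)%N k| * `|K| ^+ d) => x y x0 y0 xyK.
apply: ler_sum => k _; apply: (le_trans (ler_norm _)).
rewrite -mulrA normrM ler_wpM2l// ger0_norm ?mulr_ge0 ?exprn_ge0//.
have xK : x <= `|K| by rewrite (le_trans _ (ler_norm _))//; lra.
have yK : y <= `|K| by rewrite (le_trans _ (ler_norm _))//; lra.
have kd : (k <= d)%N by rewrite -ltnS.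
rewrite -[in leRHS](subnK kd) exprD.
by apply: ler_pM; rewrite ?exprn_ge0// lerXn2r// nnegrE.
Qed.

Section Steps.
Context {R : realType}.
Variables (S : {fset 'cV[int]_2}) (a : 'cV[int]_2 -> R).
Hypothesis S_ge : forall s, s \in S -> forall i : 'I_2, -1 <= s i 0.
Hypothesis a_ge0 : forall s, s \in S -> 0 <= a s.
Hypothesis a_sum1 : \sum_(s <- S) a s = 1.
Hypothesis a_mean0 : \sum_(s <- S) a s *: toR s = 0 :> 'cV[R]_2.
Hypothesis cov_posdef : posdef (cov S a).

Definition second_moment (i j : 'I_2) : R := \sum_(s <- S) a s * toR s i 0 * toR s j 0.

Lemma mean0 i : \sum_(s <- S) a s * toR s i 0 = 0.
Proof.
have := congr1 (fun z : 'cV[R]_2 => z i 0) a_mean0; rewrite summxE mxE => E.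
by rewrite -[RHS]E; apply: eq_bigr => s _; rewrite !mxE.
Qed.

Lemma stddev_sqr i : stddev S a i ^+ 2 = second_moment i i.
Proof.
rewrite /stddev sqr_sqrtr.
  by apply: eq_bigr => s _; rewrite expr2 mulrA.
by rewrite big_seq; apply: sumr_ge0 => s sS; rewrite mulr_ge0 ?sqr_ge0 ?a_ge0.
Qed.

Lemma stddev_gt0 i : 0 < stddev S a i.
Proof.
have [_ c0 c1 _] := posdef_entries cov_posdef.
have ci : 0 < cov S a i i by case: (ord2P i) => ->.
(* Since division by 0 yields 0, a vanishing deviation would make the diagonal entry of [cov] 0. *)
rewrite lt_def sqrtr_ge0 andbT; apply: contraTneq ci => s0.
by rewrite mxE s0 mul0r invr0 mulr0 ltxx.
Qed.

Lemma cov_diag i : cov S a i i = 1.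
Proof.
rewrite mxE -/(second_moment i i) -stddev_sqr expr2 divff//.
by rewrite mulf_neq0// gt_eqF// stddev_gt0.
Qed.

(** Otherwise zero mean makes every term [a s * toR s 0 0] vanish, and with them the variance of the
    first coordinate. *)
Lemma left_step : exists s, [/\ s \in S, s 0 0 = -1 & 0 < a s].
Proof.
apply: contrapT => no_left.
have nn s : s \in S -> 0 <= a s * toR s 0 0.
  move=> sS; have := a_ge0 sS; rewrite le_eqVlt => /predU1P[<-|as0]; first by rewrite mul0r.
  apply: mulr_ge0; first exact: ltW.
  rewrite mxE ler0z leNgt; apply/negP => s0; apply: no_left; exists s; split => //.
  by apply/eqP; rewrite eq_le S_ge// andbT -ltzD1 addNr.
have z s : s \in S -> a s * toR s 0 0 = 0.
  move=> sS; have := mean0 0; rewrite (big_fsetD1 s)//= => /eqP.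
  rewrite paddr_eq0 ?nn//; first by move=> /andP[/eqP].
  by rewrite big_seq; apply: sumr_ge0 => s'; rewrite in_fsetD1 => /andP[_ ?]; exact: nn.
have : second_moment 0 0 = 0.
  by rewrite /second_moment big_seq big1// => s sS; rewrite z// mul0r.
by rewrite -stddev_sqr => /eqP; rewrite sqrf_eq0 gt_eqF// stddev_gt0.
Qed.

Lemma killed_step_aplus (P : mpoly 2 R) : aplus_polynomial S a P ->
  forall y, in_quadrant y ->
  killed_step S a (fun y => peval P (toR y)) y = peval P (toR y).
Proof.
move=> [LP P0 _] y yq.
have yq' : quadrant (toR y : 'cV[R]_2).
  by move=> i; rewrite mxE ler0z; case/andP: yq => y0 y1; case: (ord2P i) => ->; exact: ltW.
have /eqP := LP _ yq'; rewrite /discrete_laplacian subr_eq0 => /eqP <-.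
rewrite /killed_step big_seq [RHS]big_seq; apply: eq_bigr => s sS.
rewrite -toRD; case: ifPn => // ys; congr (_ * _); apply/esym/P0.
have ge0 i : 0 <= (y + s) i 0.
  have := S_ge sS i; rewrite mxE; case/andP: yq => y0 y1.
  rewrite -(subrr 1) => si; apply: lerD si.
  by case: (ord2P i) => ->; rewrite -gtz0_ge1.
have yqs : quadrant (toR (y + s) : 'cV[R]_2) by move=> i; rewrite mxE ler0z.
move: ys; rewrite /in_quadrant negb_and -!leNgt => /orP[] h;
  [apply: (quadrant_boundary (i := 0)) => //|apply: (quadrant_boundary (i := 1)) => //];
  by apply/eqP; rewrite mxE intr_eq0 eq_le h ge0.
Qed.

(** As [cov] has unit diagonal, the rows q_0, q_1 of its symmetric square root are unit vectors with
    inner product - cos b. Hence the rows q_0 + cos b q_1 and sin b q_1 of [M] are orthogonal, both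
    of length |sin b|. *)
Lemma sector_mx_conformal b (M : 'M[R]_2) : cos b = - cov S a 0 1 ->
  M = sector_mx (sqrtmx (cov S a)) b ->
  M 0 0 ^+ 2 + M 0 1 ^+ 2 = M 1 0 ^+ 2 + M 1 1 ^+ 2 /\
  M 0 0 * M 1 0 + M 0 1 * M 1 1 = 0.
Proof.
move=> cb ->; have [[Qsym _] QQ] := sqrtmxP cov_posdef.
move: (sqrtmx _) Qsym QQ => Q Qsym QQ.
have c00 := cov_diag 0; have c11 := cov_diag 1.
have [c10 _ _ _] := posdef_entries cov_posdef.
have Q10 : Q 1 0 = Q 0 1 by rewrite -{1}Qsym mxE.
rewrite -QQ !mulmx2E Q10 in c00 c11; rewrite -QQ mulmx2E in cb.
have sb := cos2Dsin2 b.
have ME j : sector_mx Q b 0 j = Q 0 j + cos b * Q 1 j /\ sector_mx Q b 1 j = sin b * Q 1 j.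
  by rewrite /sector_mx !mulmx2E !mxE/= mul1r mul0r add0r.
have [M00 M10] := ME 0; have [M01 M11] := ME 1.
rewrite M00 M01 M10 M11 Q10; move: c00 c11 cb sb.
move: (Q 0 0) (Q 0 1) (Q 1 1) (cos b) (sin b) => p q r c s h1 h2 h3 h4.
split.
  have -> : (p + c * q) ^+ 2 + (q + c * r) ^+ 2 =
     (p * p + q * q) + 2 * c * (p * q + q * r) + c ^+ 2 * (q * q + r * r) by ring.
  have -> : (s * q) ^+ 2 + (s * r) ^+ 2 = s ^+ 2 * (q * q + r * r) by ring.
  have -> : p * q + q * r = - c by lra.
  have -> : s ^+ 2 = 1 - c ^+ 2 by lra.
  by rewrite h1 h2; ring.
have -> : (p + c * q) * (s * q) + (q + c * r) * (s * r) =
   s * ((p * q + q * r) + c * (q * q + r * r)) by ring.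
by rewrite h2 (_ : p * q + q * r = - c); [ring|lra].
Qed.

End Steps.

Theorem theorem3 (R : realType) (S : {fset 'cV[int]_2}) (a : 'cV[int]_2 -> R)
    (S_ge : forall s, s \in S -> forall i : 'I_2, -1 <= s i 0)
    (a_ge0 : forall s, s \in S -> 0 <= a s)
    (a_sum1 : \sum_(s <- S) a s = 1)
    (a_mean0 : \sum_(s <- S) a s *: toR s = 0 :> 'cV[R]_2)
    (cov_posdef : posdef (cov S a))
    (cone_weyl : exists2 G : set 'M[R]_2,
       finite_coxeter_group G & weyl_chamber G (cone S a))
    (P : mpoly 2 R) (P_aplus : aplus_polynomial S a P)
    (d : measure_display) (T : measurableType d) (Pr : probability T R)
    (X : nat -> T -> 'cV[int]_2) (X_iid : iid_steps Pr X S a)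
    (u : 'cV[R]_2 -> R) (u_reduite : is_reduite (cone S a) u) :
  exists2 kappa : R, 0 < kappa &
    forall x : 'cV[int]_2, (forall i : 'I_2, 1 <= x i 0) ->
      cvgn (killed_expectation Pr X (reduite_pullback S a u) x) /\
      dw_harmonic Pr X S a u x = (kappa * peval P (toR x))%:E.
Proof.
have [LP P0 Ppos] := P_aplus.
pose s0 := stddev S a 0; pose s1 := stddev S a 1.
have s00 : 0 < s0 by exact: stddev_gt0.
have s10 : 0 < s1 by exact: stddev_gt0.
have s0N : s0 != 0 by rewrite gt_eqF.
have s1N : s1 != 0 by rewrite gt_eqF.
pose rho := cov S a 0 1.
have rhoE : rho = second_moment S a 0 1 / (s0 * s1) by rewrite /rho mxE.
have rho1 : rho ^+ 2 < 1.
  have [_ _ _] := posdef_entries cov_posdef.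
  by rewrite !cov_diag// mulr1 subr_gt0.
have nrho : -1 < - rho < 1 by apply/andP; split; nra.
have nrho' : -1 <= - rho <= 1 by case/andP: nrho => *; rewrite !ltW.
(* Interior angle of the cone: its edges are the columns of the inverse of [Q], whose Gram matrix is
   the inverse of [cov], with off-diagonal entry - rho / (1 - rho ^ 2). *)
pose b := acos (- rho).
have cb : cos b = - rho by rewrite /b acosK// in_itv.
have b0 : 0 < b by rewrite acos_gt0//; case/andP: nrho => h1 h2; rewrite (ltW h1).
have bpi : b < pi by rewrite acos_ltpi//; case/andP: nrho => h1 h2; rewrite h1 ltW.
have b01 : 0 < b < pi by rewrite b0.
have sb : 0 < sin b by exact: sin_gt0_pi.
have [n [c [cn PE HE]]] := mpoly_bipoly P.
pose pt2 (x y : R) : 'cV[R]_2 := \col_i (if i == 0 then x else y).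
have pt20 x y : pt2 x y 0 0 = x by rewrite mxE.
have pt21 x y : pt2 x y 1 0 = y by rewrite mxE.
have pt2q x y : 0 <= x -> 0 <= y -> quadrant (pt2 x y).
  by move=> x0 y0 i; case: (ord2P i) => ->; rewrite ?pt20 ?pt21.
have [ci cj] : (forall i, c i 0%N = 0) /\ (forall j, c 0%N j = 0).
  apply: (bipoly_axes cn) => x x0.
    have := P0 (pt2 x 0); rewrite PE pt20 pt21; apply.
    by apply: (quadrant_boundary (i := 1)) => //; apply: pt2q => //; exact: ltW.
  have := P0 (pt2 0 x); rewrite PE pt20 pt21; apply.
  by apply: (quadrant_boundary (i := 0)) => //; apply: pt2q => //; exact: ltW.
(* Chosen so that y_0 / s0 + (y_1 / s1) exp (i b) is zeta (y) / s0: normalizing by the deviations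
   only rescales zeta. *)
pose l := s0 / s1.
have l0 : 0 < l by rewrite divr_gt0.
pose M i j := second_moment S a i j.
have M11 : M 1 1 = s1 ^+ 2 by rewrite /M -stddev_sqr.
have M00 : M 0 0 = M 1 1 * l ^+ 2.
  by rewrite M11 /l /M -stddev_sqr// -/s0; field.
have M01 : M 0 1 = - (M 1 1 * l * cos b).
  by rewrite M11 cb rhoE /l -/(M 0 1); field; rewrite s1N.
have harm x y : 0 < x -> 0 < y ->
    \sum_(s <- S) a s * bipoly c n (x + toR s 0 0) (y + toR s 1 0) - bipoly c n x y = 0.
  move=> x0 y0; have := LP (pt2 x y) (pt2q _ _ (ltW x0) (ltW y0)).
  rewrite /discrete_laplacian PE pt20 pt21 => E; rewrite -[RHS]E; congr (_ - _).
  by apply: eq_bigr => s _; rewrite PE !mxE.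
have rec := harmonic_recurrence cn a_sum1 (mean0 a_mean0 0) (mean0 a_mean0 1) harm.
have M11p : 0 < M 1 1 by rewrite M11 exprn_gt0.
have [kap [ck Hk]] := top_form_cpow l0 b01 M11p M00 M01 (ci n) rec.
have Hpos x y : 0 < x -> 0 < y -> 0 < top_form c n x y.
  move=> x0 y0; have := Ppos (pt2 x y); rewrite HE pt20 pt21; apply.
  by move=> i; case: (ord2P i) => ->; rewrite ?pt20 ?pt21.
have [kap0 nb] : 0 < kap /\ n%:R * b = pi.
  apply: sector_angle => // [t /andP[t0 tb]|].
    (* The coordinates of the point of the open quadrant at which zeta equals exp (i t). *)
    have y0 : 0 < sin t / (l * sin b).
      have st : 0 < sin t by apply: sin_gt0_pi; rewrite t0 (lt_trans tb).
      by rewrite divr_gt0// mulr_gt0.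
    have x0 : 0 < sin (b - t) / sin b.
      have st : 0 < sin (b - t) by apply: sin_gt0_pi; apply/andP; split; lra.
      by rewrite divr_gt0.
    have := Hpos _ _ x0 y0; rewrite Hk.
    have -> : l * (sin t / (l * sin b)) * sin b = 1 * sin t.
      by field; rewrite !gt_eqF.
    have -> : sin (b - t) / sin b + l * (sin t / (l * sin b)) * cos b = 1 * cos t.
      by rewrite sinB; field; rewrite !gt_eqF.
    by rewrite cpow_polar/= expr1n mul1r.
  (* The pure power of y has coefficient 0, and by the closed form this coefficient is kap l ^ n sin
     (n b). *)
  have := ck n (leqnn n); rewrite subnn cj binn mul1r => /esym/eqP.
  rewrite mulf_eq0 => /orP[|/eqP ->]; last by rewrite mulr0.
  by rewrite mulf_eq0 expf_eq0 (gt_eqF l0) andbF orbF => /eqP ->; rewrite mul0r.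
have n2 : (1 < n)%N.
  rewrite ltnNge; apply/negP; rewrite leq_eqVlt ltnS leqn0 => /orP[] /eqP nn; move: nb; rewrite nn.
    by rewrite mul1r => bb; move: bpi; rewrite bb ltxx.
  by rewrite mul0r => pp; have := @pi_gt0 R; rewrite -pp ltxx.
set Q := sqrtmx (cov S a).
have [_ QQ] := sqrtmxP cov_posdef; rewrite -/Q in QQ.
have Qu : Q \in unitmx.
  have : cov S a \in unitmx.
    have [c10 _ _ cdet] := posdef_entries cov_posdef.
    by apply: unitmx2; rewrite c10 -expr2 gt_eqF.
  by rewrite -QQ unitmx_mul => /andP[].
have [conf1 conf2] := sector_mx_conformal a_ge0 cov_posdef cb erefl.
have [ku ku0 uE] := reduite_sector Qu b0 bpi nb conf1 conf2 u_reduite.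
(* If the rescaled point has polar coordinates r, t, then zeta (y) = s0 r exp (i t); so [H] is kap
   s0 ^ n r ^ n sin (n t), while the reduite is ku r ^ n sin (n t). *)
pose kappa := ku / (kap * s0 ^+ n).
have kappa0 : 0 < kappa by rewrite divr_gt0// mulr_gt0// exprn_gt0.
pose H (y : 'cV[int]_2) := top_form c n (y 0 0)%:~R (y 1 0)%:~R.
have pullE y : in_quadrant y -> reduite_pullback S a u (toR y) = kappa * H y.
  move=> yq; have y0 : (0 : R) < (y 0 0)%:~R by rewrite ltr0z; case/andP: yq.
  have y1 : (0 : R) < (y 1 0)%:~R by rewrite ltr0z; case/andP: yq.
  rewrite /reduite_pullback /cov_invsqrt -/Q.
  set D := diag_mx _.
  have -> : invmx D *m toR y = pt2 ((y 0 0)%:~R / s0) ((y 1 0)%:~R / s1).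
    have Du : D \in unitmx.
      by rewrite unitmxE det_diag unitfE big_ord_recl big_ord1 !mxE mulf_neq0// gt_eqF// stddev_gt0.
    rewrite -[RHS](mulKmx Du); congr (_ *m _); apply/matrixP => i j.
    rewrite (ord1 j) mul_diag_mx !mxE.
    by case: (ord2P i) => ->/=; rewrite mulrC divfK.
  set z := invmx Q *m _.
  have z0 : mrow Q 0 z = (y 0 0)%:~R / s0 by rewrite /mrow mulKVmx// pt20.
  have z1 : mrow Q 1 z = (y 1 0)%:~R / s1 by rewrite /mrow mulKVmx// pt21.
  have zpos i : 0 < mrow Q i z by case: (ord2P i) => ->; rewrite ?z0 ?z1 divr_gt0.
  have [r [t [r0 /andP[t0 tb] zE _]]] := sector_polar Qu b0 bpi zpos.
  have [F0 F1] := mrow_sector Qu b0 bpi r t.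
  have [G0 G1] := mrow_sector_mx Q b z.
  rewrite z0 z1 zE F0 in G0; rewrite z1 zE F1 in G1.
  rewrite zE uE ?(ltW r0)//; last by rewrite !ltW.
  rewrite /H Hk.
  have -> : (y 0 0)%:~R + l * (y 1 0)%:~R * cos b = (s0 * r) * cos t.
    by rewrite -[s0 * r * cos t]mulrA G0 /l; field; rewrite s1N.
  have -> : l * (y 1 0)%:~R * sin b = (s0 * r) * sin t.
    by rewrite -[_ * sin t]mulrA G1 /l; field.
  rewrite cpow_polar/= exprMn /kappa; field.
  by rewrite (gt_eqF kap0) (gt_eqF (exprn_gt0 n s00)).
have [sl [slS sl1 al0]] := left_step S_ge a_ge0 a_mean0 cov_posdef.
have Hp y : in_quadrant y -> 0 < H y.
  by move=> /andP[y0 y1]; apply: Hpos; rewrite ltr0z.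
have [C0 C00 HC0] := sector_form_ge kap0 l0 b01 nb.
have [C1 C10 HC1] := lower_order_le n2 cn ci cj.
exists kappa => // x x1.
have xq : in_quadrant x by rewrite /in_quadrant !gtz0_ge1 !x1.
have Hcvg : (fun m => killed S a m H x) @ \oo --> peval P (toR x).
  (* The form x y (x + y) ^ (n - 2) links both estimates: times [C1] it dominates (x + y) |P - H|,
     times [C0] it is at most [H]. *)
  apply: (@killed_cvg _ S a a_ge0 a_sum1 sl x (fun y => peval P (toR y)) H (C1 / C0)) => //.
  - exact: killed_step_aplus.
  - by move=> y /Hp/ltW.
  - move=> y /[dup] yq /andP[y0 y1].
    rewrite PE !mxE intrD.
    have y0R : (1 : R) <= (y 0 0)%:~R by rewrite -[1]/(1%:~R) ler_int -gtz0_ge1.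
    have y1R : (1 : R) <= (y 1 0)%:~R by rewrite -[1]/(1%:~R) ler_int -gtz0_ge1.
    apply: (le_trans (HC1 _ _ y0R y1R)).
    rewrite [leRHS]mulrAC ler_pdivlMr// -[leLHS]mulrA ler_wpM2l// mulrC /H Hk.
    by apply: HC0; lra.
  - by rewrite divr_ge0// ltW.
  - move=> K; have [B HB] := top_form_bounded c n K; exists B => y /andP[y0 y1] yK.
    by apply: HB; [rewrite ler0z ltW|rewrite ler0z ltW|rewrite -intrD].
have Kcvg : killed_expectation Pr X (reduite_pullback S a u) x @ \oo -->
    (kappa * peval P (toR x))%:E.
  have -> : killed_expectation Pr X (reduite_pullback S a u) x =
      EFin \o (fun m => kappa * killed S a m H x).
    apply/funext => m /=; rewrite (killed_expectationE a_sum1 X_iid) -killedZ.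
    by congr EFin; apply: eq_killed.
  by apply: cvg_EFin; [exact: nearW|exact: cvgM (cvg_cst _) Hcvg].
split; first by apply/cvg_ex; exists (kappa * peval P (toR x))%:E.
exact: cvg_lim.
Qed.
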